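(* Let $\mathcal{C}\subset\mathbb{Z}^n$ be a circuit and let $N$ be the number of real solutions of a generic real polynomial system supported on $\mathcal{C}$. Then: (1) if $\mathrm{rk}(\bar{\mathcal{C}})\le m(\mathcal{C})$, then $N\le 2^{\,n-\mathrm{rk}(\bar{\mathcal{C}})}\big(m(\mathcal{C})+\mathrm{rk}(\bar{\mathcal{C}})+1\big)$; (2) if $\mathrm{rk}(\bar{\mathcal{C}})\ge m(\mathcal{C})$, then $N\le 2^{\,n-\mathrm{rk}(\bar{\mathcal{C}})}\big(2m(\mathcal{C})+1\big)$.
   Context: A circuit is a set $\mathcal{C}\subset\mathbb{Z}^n$ of $n+2$ points whose affine span is $\mathbb{R}^n$; it contains a unique minimal affinely dependent subset, and $m(\mathcal{C})$ denotes the dimension of the affine span of that subset (so $1\le m(\mathcal{C})\le n$). The rank modulo $2$ of $\mathcal{C}$, $\mathrm{rk}(\bar{\mathcal{C}})$, is the rank over $\mathbb{Z}/2$ of the matrix whose columns are the reductions modulo $2$ of the vectors $w-w'$, $w\in\mathcal{C}$, for a fixed $w'\in\mathcal{C}$ (equivalently, after translating $\mathcal{C}$ so that $0\in\mathcal{C}$, of the nonzero elements of $\mathcal{C}$). A real polynomial system supported on $\mathcal{C}$ is a system of $n$ Laurent polynomial equations $F_1=\dots=F_n=0$ in $x=(x_1,\dots,x_n)$ with real coefficients, where each $F_j$ has support $\mathcal{C}$ (the set of exponent vectors of its monomials with nonzero coefficient). Such a system is generic if its number of solutions in $(\mathbb{C}^* )^n$ equals the normalized volume $v(\mathcal{C})$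 of the convex hull of $\mathcal{C}$ (normalized so that $[0,1]^n$ has volume $n!$). Real solutions are solutions in $(\mathbb{R}^* )^n$. *)

(* Defs.v *)
From HB Require Import structures.
From Stdlib Require Import Reals.
From mathcomp Require Import all_boot all_order all_algebra.
From mathcomp Require Import complex.
From mathcomp Require Import Rstruct.

Set Implicit Arguments.
Unset Strict Implicit.
Unset Printing Implicit Defensive.

Import Order.TTheory GRing.Theory Num.Theory.
Local Open Scope ring_scope.

Definition config (n : nat) := 'I_n.+2 -> 'rV[int]_n.

Definition toR n (z : 'rV[int]_n) : 'rV[R]_n := map_mx (fun a : int => a%:~R) z.

Definition full_affine_span n (w : config n) : Prop :=
  \rank (\matrix_(i < n.+2) (toR (w i) - toR (w ord0))) = n.

Definition is_circuit n (w : config n) : Prop :=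
  injective w /\ full_affine_span w.

Definition aff_dependent n (w : config n) (S : {set 'I_n.+2}) : Prop :=
  exists lam : 'I_n.+2 -> R,
    (exists2 i, i \in S & lam i != 0) /\
    (forall i, i \notin S -> lam i = 0) /\
    \sum_i lam i = 0 /\
    \sum_i lam i *: toR (w i) = 0.

Definition min_aff_dependent n (w : config n) (S : {set 'I_n.+2}) : Prop :=
  aff_dependent w S /\ (forall T : {set 'I_n.+2}, T \proper S -> ~ aff_dependent w T).

Definition affine_dim n (w : config n) (S : {set 'I_n.+2}) : nat :=
  let j0 := odflt ord0 [pick j in S] in
  \rank (\matrix_(i < n.+2) (if i \in S then toR (w i) - toR (w j0) else 0)).

Definition rank_mod2 n (w : config n) : nat :=
  \rank (\matrix_(k < n, i < n.+2) ((w i 0 k - w ord0 0 k)%:~R : 'F_2)).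

Definition monom (F : unitRingType) n (x : 'rV[F]_n) (a : 'rV[int]_n) : F :=
  \prod_(k < n) (x 0 k) ^ (a 0 k).

Definition sys_eval (F : unitRingType) (f : R -> F) n (c : 'M[R]_(n, n.+2))
  (w : config n) (j : 'I_n) (x : 'rV[F]_n) : F :=
  \sum_(i < n.+2) f (c j i) * monom x (w i).

Definition full_support n (c : 'M[R]_(n, n.+2)) : Prop :=
  forall j i, c j i != 0.

Definition real_solution n (c : 'M[R]_(n, n.+2)) (w : config n) (x : 'rV[R]_n) : Prop :=
  (forall k, x 0 k != 0) /\ (forall j, sys_eval id c w j x = 0).

Definition complex_solution n (c : 'M[R]_(n, n.+2)) (w : config n)
  (x : 'rV[complex R]_n) : Prop :=
  (forall k, x 0 k != 0) /\
  (forall j, sys_eval (fun r : R => (r%:C)%C) c w j x = 0).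

Definition in_dilated_hull n (w : config n) (k : nat) (z : 'rV[int]_n) : Prop :=
  exists lam : 'I_n.+2 -> R,
    (forall i, 0 <= lam i) /\ \sum_i lam i = k%:R /\
    toR z = \sum_i lam i *: toR (w i).

Definition lattice_count n (w : config n) (k N : nat) : Prop :=
  exists s : seq 'rV[int]_n, uniq s /\ size s = N /\
    (forall z, z \in s <-> in_dilated_hull w k z).

(* v is the normalized volume n! * vol(conv C); the Euclidean volume of the
   lattice polytope conv C is computed as lim_k #(kP cap Z^n) / k^n. *)
Definition normalized_volume n (w : config n) (v : nat) : Prop :=
  exists cnt : nat -> nat,
    (forall k, lattice_count w k (cnt k)) /\
    Un_cv (fun k => (cnt k)%:R / (k%:R ^+ n)) (v%:R / (n`!)%:R).

Definition generic_system n (c : 'M[R]_(n, n.+2)) (w : config n) : Prop :=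
  exists2 v, normalized_volume w v &
    exists s : seq 'rV[complex R]_n, uniq s /\ size s = v /\
      (forall x, x \in s <-> complex_solution c w x).

(* Main.v *)
Require Import Defs.
From Stdlib Require Import Reals.
From mathcomp Require Import all_boot all_order all_algebra.
From mathcomp Require Import complex Rstruct.
From mathcomp Require Import mxabelem ring lra zify.

Set Implicit Arguments.
Unset Strict Implicit.
Unset Printing Implicit Defensive.

Import Order.TTheory GRing.Theory Num.Theory.
Local Open Scope ring_scope.

(* By Smith normal form, a torus point is determined up to finitely many choices
   by its monomials [x^(w_i)] normalized at some [i0] in [S], and a vector [u]
   with nonzero coordinates is, over the complex numbers, a normalized monomial
   vector iff [prod_i u_i^(l_i) = 1], where [l] is a primitive affine relation
   of [w], supported on [S].  So real solutions lie over real points [u] of an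
   affine space (the kernel of [c], normalized) satisfying this one equation,
   with fibres of size at most [2^(n - rk)].
   Having finitely many complex solutions forces this affine space to be a
   line, on which [G = prod_(i in S) L_i^(l_i)] is not constant.  Between
   consecutive solutions either [G'/G], whose numerator has degree at most
   [|S| - 2 = m], has a root, or some [L_i] with [i] in [S] changes sign.  An
   [L_i] changes sign at most once, so the latter gaps produce linearly
   independent vectors of F_2^S; together with the all-one vector they lie in
   the space of sign vectors of monomials, of dimension at most [rk + 1], and at
   most [m + 1] because [l] is nonzero modulo 2.  Hence the line carries at most
   [min(rk, m) + m + 1] solution points. *)

(** * Monomial maps *)

Definition torus (F : fieldType) n (x : 'rV[F]_n) := [forall k, x 0 k != 0].

Lemma torusP (F : fieldType) n (x : 'rV[F]_n) :
  reflect (forall k, x 0 k != 0) (torus x).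
Proof. exact: forallP. Qed.

Definition pow_mx (F : fieldType) m n (x : 'rV[F]_n) (A : 'M[int]_(m, n)) :
  'rV[F]_m := \row_i monom x (row i A).

Lemma monom_neq0 (F : fieldType) n (x : 'rV[F]_n) a :
  torus x -> monom x a != 0.
Proof.
by move/torusP=> x0; apply/prodf_neq0 => k _; rewrite expfz_neq0.
Qed.

Lemma monomD (F : fieldType) n (x : 'rV[F]_n) a b :
  torus x -> monom x (a + b) = monom x a * monom x b.
Proof.
move/torusP=> x0; rewrite /monom -big_split; apply: eq_bigr => k _.
by rewrite mxE expfzDr.
Qed.

Lemma monom0 (F : fieldType) n (x : 'rV[F]_n) : monom x 0 = 1.
Proof. by rewrite /monom big1 // => k _; rewrite mxE expr0z. Qed.

Lemma monomMz (F : fieldType) n (x : 'rV[F]_n) a z :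
  monom x (z *: a) = monom x a ^ z.
Proof.
rewrite /monom.
rewrite (big_morph (fun y : F => y ^ z) (id1 := 1) (op1 := *%R)); last exact: exp1rz.
  by apply: eq_bigr => k _; rewrite mxE exprzAC exprz_exp.
by move=> y1 y2; rewrite expfzMl.
Qed.

Lemma monom_sum (F : fieldType) n (x : 'rV[F]_n) (I : Type) (r : seq I) a :
  torus x -> monom x (\sum_(i <- r) a i) = \prod_(i <- r) monom x (a i).
Proof.
move=> x0; apply: (big_morph (monom x)); last exact: monom0.
by move=> a1 a2; rewrite monomD.
Qed.

Lemma monom_div (F : fieldType) n (x y : 'rV[F]_n) a :
  monom (\row_k (x 0 k / y 0 k)) a = monom x a / monom y a.
Proof.
rewrite /monom -prodfV -big_split; apply: eq_bigr => k _.
by rewrite mxE expfzMl exprz_inv -invr_expz.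
Qed.

Lemma pow_mx_torus (F : fieldType) m n (x : 'rV[F]_n) (A : 'M[int]_(m, n)) :
  torus x -> torus (pow_mx x A).
Proof. by move=> x0; apply/torusP => i; rewrite mxE monom_neq0. Qed.

Lemma monom_pow_mx (F : fieldType) m n (x : 'rV[F]_n) (A : 'M[int]_(m, n)) b :
  torus x -> monom (pow_mx x A) b = monom x (b *m A).
Proof.
move=> x0; rewrite mulmx_sum_row monom_sum //; apply: eq_bigr => i _.
by rewrite mxE monomMz.
Qed.

Lemma pow_mx_mul (F : fieldType) m n p (x : 'rV[F]_n) (A : 'M[int]_(m, n))
    (B : 'M[int]_(p, m)) :
  torus x -> pow_mx x (B *m A) = pow_mx (pow_mx x A) B.
Proof.
by move=> x0; apply/rowP => i; rewrite !mxE monom_pow_mx // row_mul.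
Qed.

Lemma monom_delta (F : fieldType) n (x : 'rV[F]_n) k :
  monom x (delta_mx 0 k) = x 0 k.
Proof.
rewrite /monom (bigD1 k) //= big1 ?mulr1; last first.
  by move=> j /negPf jk; rewrite mxE jk andbF expr0z.
by rewrite mxE !eqxx expr1z.
Qed.

Lemma pow_mx1 (F : fieldType) n (x : 'rV[F]_n) : pow_mx x 1%:M = x.
Proof. by apply/rowP => i; rewrite mxE row1 monom_delta. Qed.

Lemma pow1_mx (F : fieldType) m n (A : 'M[int]_(m, n)) :
  pow_mx (const_mx 1 : 'rV[F]_n) A = const_mx 1.
Proof.
apply/rowP => i; rewrite !mxE /monom big1 // => k _.
by rewrite mxE exp1rz.
Qed.

Definition diag_rect m n (d : nat -> int) : 'M[int]_(m, n) :=
  \matrix_(i, j) (d i *+ (i == j :> nat)).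

Lemma pow_mx_diag (F : fieldType) m n d (x : 'rV[F]_n) (i : 'I_m) (k : 'I_n) :
  i = k :> nat -> pow_mx x (diag_rect m n d) 0 i = x 0 k ^ d k.
Proof.
move=> ik; rewrite mxE -[x 0 k]monom_delta -monomMz; congr monom.
apply/rowP => j; rewrite !mxE ik eqxx /= -[LHS]mulr_natr.
by congr (_ * _%:R); rewrite eq_sym.
Qed.

(** * Smith normal form of a full-rank integer matrix *)

Definition smith_form m (A : 'M[int]_(m.+1, m)) (P : 'M[int]_m.+1)
    (Q : 'M[int]_m) (d : nat -> int) : Prop :=
  [/\ P \in unitmx, Q \in unitmx, (forall j : 'I_m, d j != 0)
    & A = P *m diag_rect m.+1 m d *m Q].

Lemma smith_form_exists m (A : 'M[int]_(m.+1, m)) :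
  (forall v : 'cV[int]_m, A *m v = 0 -> v = 0) ->
  exists P Q d, smith_form A P Q d.
Proof.
move=> Ainj; have [P uP [Q uQ [d _ AE]]] := int_Smith_normal_form A.
exists P, Q, (nth 0 d); split=> //.
move=> j; apply/eqP => dj0.
have /Ainj v0 : A *m (invmx Q *m delta_mx j 0 : 'cV_m) = 0.
  rewrite AE -!mulmxA [Q *m _]mulmxA mulmxV // mul1mx.
  rewrite -colE; set X := col j _; suff -> : X = 0 by rewrite mulmx0.
  apply/colP => i; rewrite !mxE; case: eqP => [->|]; last by rewrite mulr0n.
  by rewrite dj0 mul0rn.
have : (delta_mx j 0 : 'cV[int]_m) j 0 = 0.
  by rewrite -[delta_mx _ _]mul1mx -(mulmxV uQ) -mulmxA v0 mulmx0 mxE.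
by rewrite mxE !eqxx.
Qed.

(** The diagonal factor of [A] has a zero last row, so this row spans the left kernel; coming from a
    unimodular matrix, it is primitive. *)
Definition smith_rel m (P : 'M[int]_m.+1) : 'rV[int]_m.+1 :=
  row ord_max (invmx P).

Lemma smith_rel_mul m (P : 'M[int]_m.+1) : P \in unitmx ->
  smith_rel P *m P = delta_mx 0 ord_max.
Proof. by move=> uP; rewrite -row_mul mulVmx // row1. Qed.

Lemma smith_relA m (A : 'M[int]_(m.+1, m)) P Q d : smith_form A P Q d ->
  smith_rel P *m A = 0.
Proof.
case=> uP _ _ ->; rewrite !mulmxA smith_rel_mul // -rowE.
rewrite [X in X *m _](_ : _ = 0) ?mul0mx //; apply/rowP => j.
by rewrite !mxE /= gtn_eqF ?mulr0n.
Qed.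

(** [mu *m P] is annihilated by the diagonal factor, whose entries [d j] stay nonzero in
    characteristic zero and kill every coordinate but the last. *)
Lemma smith_rel_unique (F : numFieldType) m (A : 'M[int]_(m.+1, m)) P Q d
    (mu : 'rV[F]_m.+1) : smith_form A P Q d ->
  mu *m map_mx intr A = 0 ->
  exists t, mu = t *: map_mx intr (smith_rel P).
Proof.
case=> uP uQ d0 ->; rewrite !map_mxM /= => muA0.
have mapV n (B : 'M[int]_n) : B \in unitmx ->
    map_mx (intr : int -> F) B *m map_mx intr (invmx B) = 1%:M.
  by move=> uB; rewrite -map_mxM mulmxV // map_mx1.
move: muA0.
have [nu nuE] : exists nu, mu *m map_mx intr P = nu by exists (mu *m map_mx intr P).
rewrite !mulmxA nuE => muA0.
have nuD : nu *m map_mx intr (diag_rect m.+1 m d) = 0.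
  have := congr1 (fun X => X *m map_mx intr (invmx Q)) muA0.
  by rewrite mul0mx -[_ *m map_mx intr Q *m _]mulmxA mapV // mulmx1.
have nuj (j : 'I_m) : nu 0 (widen_ord (leqnSn m) j) = 0.
  move/rowP: nuD => /(_ j); rewrite !mxE (bigD1 (widen_ord (leqnSn m) j)) //=.
  rewrite big1 ?addr0; last first.
    by move=> i; rewrite -val_eqE /= => /negPf ij; rewrite !mxE ij mulr0n mulr0.
  rewrite [map_mx _ _ _ _]mxE [diag_rect _ _ _ _ _]mxE /= eqxx mulr1n.
  move/eqP; rewrite mulf_eq0 intr_eq0 (negPf (d0 j)) orbF.
  by move/eqP.
exists (nu 0 ord_max).
have -> : mu = nu *m map_mx intr (invmx P) by rewrite -nuE -mulmxA mapV // mulmx1.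
rewrite /smith_rel rowE map_mxM scalemxAl map_delta_mx; congr (_ *m _).
apply/rowP => j; rewrite !mxE eqxx /=; case: eqP => [->|]; first by rewrite mulr1.
case: (unliftP ord_max j) => [j' ->|->] // _; rewrite mulr0.
by rewrite -(nuj j'); congr (nu 0 _); apply: val_inj; rewrite /= /bump leqNgt ltn_ord.
Qed.

Lemma smith_rel_mod2 m (P : 'M[int]_m.+1) : P \in unitmx ->
  map_mx (intr : int -> 'F_2) (smith_rel P) != 0.
Proof.
move=> uP; apply/eqP => l0.
have := congr1 (fun X => map_mx (intr : int -> 'F_2) X 0 ord_max) (smith_rel_mul uP).
by rewrite map_mxM /= l0 mul0mx !mxE !eqxx.
Qed.

(* The Smith form turns the monomial map into [y_j |-> y_j ^ d_j], which is
   onto over an algebraically closed field. *)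
Lemma pow_mx_lift (F : closedFieldType) m (A : 'M[int]_(m.+1, m)) P Q d
    (z : 'rV[F]_m.+1) : smith_form A P Q d -> torus z ->
  monom z (smith_rel P) = 1 ->
  exists2 y, torus y & pow_mx y A = z.
Proof.
case=> uP uQ d0 -> z0 zl.
set z' := pow_mx z (invmx P).
have tz' : torus z' by apply: pow_mx_torus.
have root (j : 'I_m) : {y : F | y != 0 & y ^ d j = z' 0 (widen_ord (leqnSn m) j)}.
  have /torusP/(_ (widen_ord (leqnSn m) j)) zj := tz'; move: (_ 0 _) zj => a a0.
  have rootn k : (0 < k)%N -> {y : F | y != 0 & y ^+ k = a}.
    move=> k0; have := @solve_monicpoly F k (fun i => if i == 0%N then a else 0) k0.
    move=> ex; have /sigW[y /eqP ye] : exists y : F, y ^+ k == a.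
      have [y ye] := ex; exists y; apply/eqP; rewrite ye; case: k k0 {ex ye} => // k _.
      by rewrite big_ord_recl /= expr0 mulr1 big1 ?addr0 // => i _; rewrite mul0r.
    exists y => //; apply: contraNneq a0 => y0.
    by rewrite -ye y0 expr0n eqn0Ngt k0.
  have := d0 j; case: (d j) => k k0; first by case: (rootn k) => [|y]; [lia|exists y].
  case: (rootn k.+1) => // y y0 ye; exists y^-1; first by rewrite invr_eq0.
  by rewrite exprz_inv NegzE opprK.
pose y' := \row_j s2val (root j).
have ty' : torus y' by apply/torusP => j; rewrite mxE; case: (root j).
have ty : torus (pow_mx y' (invmx Q)) by apply: pow_mx_torus.
exists (pow_mx y' (invmx Q)) => //.
rewrite pow_mx_mul // -(pow_mx_mul (invmx Q) Q) // mulmxV // pow_mx1 pow_mx_mul //.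
suff -> : pow_mx y' (diag_rect m.+1 m d) = z'.
  by rewrite /z' -pow_mx_mul // mulmxV // pow_mx1.
apply/rowP => i; case: (unliftP ord_max i) => [j|] ->.
  have jE : lift ord_max j = widen_ord (leqnSn m) j.
    by apply: val_inj; rewrite /= /bump leqNgt ltn_ord.
  by rewrite (pow_mx_diag _ _ (k := j)) ?jE // mxE; case: (root j).
(* The zero last row of the diagonal matrix gives the value 1; the hypothesis on [smith_rel P] gives
   the same for [z']. *)
rewrite [RHS]mxE -/(smith_rel P) zl mxE /monom big1 // => j _.
rewrite (_ : row ord_max (diag_rect m.+1 m d) 0 j = 0) ?expr0z //.
by rewrite mxE [LHS]mxE /= gtn_eqF ?mulr0n.
Qed.

(** Cancelling [P] leaves [z_j ^ d_j = 1] for [z = pow_mx y Q], which in an ordered field forces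
    [z_j ^ 2 = 1]. Each [y_k] is a monomial in [z], so its square is 1 as well. *)
Lemma pow_mx_sign (F : realFieldType) m (A : 'M[int]_(m.+1, m)) P Q d
    (y : 'rV[F]_m) : smith_form A P Q d -> torus y ->
  pow_mx y A = const_mx 1 -> forall k, y 0 k = 1 \/ y 0 k = -1.
Proof.
case=> uP uQ d0 -> ty yA k.
have [z zE] : exists z, pow_mx y Q = z by exists (pow_mx y Q).
have tz : torus z by rewrite -zE pow_mx_torus.
have normX (x : F) n : `|x ^ n| = `|x| ^ n.
  by case: n => i; rewrite ?NegzE -?invr_expz ?normfV normrX.
have zj j : z 0 j ^ 2 = 1.
  move: yA; rewrite pow_mx_mul // zE pow_mx_mul //.
  move/(congr1 (fun u => pow_mx u (invmx P))).
  rewrite pow1_mx -pow_mx_mul ?pow_mx_torus // mulVmx // pow_mx1.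
  move/rowP => /(_ (widen_ord (leqnSn m) j)).
  rewrite (pow_mx_diag _ _ (k := j)) // [const_mx 1 0 _]mxE => /(congr1 Num.norm).
  rewrite normX normr1 -[_ ^ 2]real_normK ?num_real //.
  have := d0 j; case: (d j) => i i0 /eqP.
    by rewrite pexprn_eq1 // => /orP[|/eqP ->]; [lia|rewrite expr1n].
  by rewrite NegzE -exprz_inv pexprn_eq1 ?invr_ge0 // invr_eq1 /= => /eqP ->; rewrite expr1n.
have /eqP : y 0 k ^ 2 = 1.
  rewrite -[y]pow_mx1 -(mulVmx uQ) pow_mx_mul // zE mxE -monomMz /monom big1 //.
  by move=> j _; rewrite mxE -exprz_exp zj exp1rz.
by rewrite sqrf_eq1 => /orP[]/eqP; [left|right].
Qed.

(** * Perturbing a solution along a two-parameter family *)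

Lemma fresh_small (F : numFieldType) (T : seq F) (e : F) : 0 < e ->
  exists s, [/\ 0 < s, s < e & s \notin T].
Proof.
move=> e0; pose c := [seq e / k.+2%:R | k <- iota 0 (size T).+1].
have uc : uniq c.
  rewrite map_inj_uniq ?iota_uniq // => i j.
  move/(mulfI (lt0r_neq0 e0))/invr_inj/eqP; rewrite eqr_nat => /eqP; lia.
have /allPn[_ /mapP[k _ ->] kT] : ~~ all (mem T) c.
  apply/negP => /allP cT; have := uniq_leq_size uc cT.
  by rewrite size_map size_iota ltnn.
exists (e / k.+2%:R); split=> //; first by rewrite divr_gt0 // ltr0n.
by rewrite ltr_pdivrMr ?ltr0n // ltr_pMr // ltr1n.
Qed.

Lemma pos_lower_bound (F : numFieldType) (e1 e2 : F) : 0 < e1 -> 0 < e2 ->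
  exists e, [/\ 0 < e, e <= e1 & e <= e2].
Proof.
move=> e10 e20; have e120 : 0 < e1 + e2 by rewrite addr_gt0.
(* This bound needs no comparison of [e1] with [e2]; the order on [F] may be partial. *)
exists (e1 * e2 / (e1 + e2)); split; first by rewrite divr_gt0 // mulr_gt0.
  by rewrite ler_pdivrMr // ler_pM2l // lerDr ltW.
by rewrite ler_pdivrMr // mulrC ler_pM2l // lerDl ltW.
Qed.

Lemma horner_cont0 (F : numFieldType) (p : {poly F}) (e : F) : 0 < e ->
  exists2 d, 0 < d & forall s, `|s| < d -> `|p.[s] - p.[0]| < e.
Proof.
move=> e0.
have [M M0 pM] : exists2 M, 0 <= M &
    forall s : F, `|s| <= 1 -> `|p.[s] - p.[0]| <= `|s| * M.
  elim/poly_ind: p => [|p c [M M0 pM]].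
    by exists 0 => // s _; rewrite !horner0 subrr normr0 mulr0.
  exists (M + `|p.[0]|) => [|s s1]; first by rewrite addr_ge0.
  rewrite !hornerE addrK.
  rewrite normrM mulrC ler_wpM2l //.
  rewrite -[p.[s]](subrK p.[0]) (le_trans (ler_normD _ _)) // lerD2r.
  by rewrite (le_trans (pM s s1)) // ler_piMl.
have [d [d0 d1 de]] := @pos_lower_bound F 1 (e / (M + 1)) ltr01
  (divr_gt0 e0 (ltr_wpDl M0 ltr01)).
exists d => // s sd; have [s1 se] : `|s| <= 1 /\ `|s| < e / (M + 1).
  by split; [apply: ltW; apply: lt_le_trans sd _|apply: lt_le_trans sd _].
apply: le_lt_trans (pM s s1) _.
rewrite ltr_pdivlMr ?(ltr_wpDl M0 ltr01) // in se.
by apply: le_lt_trans se; rewrite ler_wpM2l // lerDl.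
Qed.

(** Each linear factor satisfies [|t - z| <= |z| (1 + |t| / e)]. Contrapositively, a polynomial
    small at 0 but not at [t] has a root of modulus below [e]. *)
Lemma horner_le_of_roots_ge (C : numClosedFieldType) (p : {poly C}) (e t : C) :
  0 < e -> (forall z, root p z -> e <= `|z|) ->
  `|p.[t]| <= `|p.[0]| * (1 + `|t| / e) ^+ (size p).-1.
Proof.
move=> e0; have [r pE] := closed_field_poly_normal p.
have [->|p0] := eqVneq p 0; first by rewrite !horner0 normr0 mul0r.
have -> : (size p).-1 = size r.
  by rewrite {1}pE size_scale ?lead_coef_eq0 // size_prod_XsubC.
have rp z : (z \in r) = root p z.
  by rewrite pE rootZ ?lead_coef_eq0 // root_prod_XsubC.
rewrite pE => rge.
rewrite !hornerZ !normrM -mulrA ler_wpM2l // !horner_prod.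
have {}rge z : z \in r -> e <= `|z|.
  by move=> zr; apply: rge; rewrite rootZ ?lead_coef_eq0 // root_prod_XsubC.
elim: r {pE rp} rge => [|z r IH] rge.
  by rewrite !big_nil expr0 mulr1.
rewrite !big_cons exprS !normrM mulrACA ler_pM //; last first.
  by apply: IH => y yr; apply: rge; rewrite inE yr orbT.
rewrite !hornerE normrN mulrDr mulr1 addrC (le_trans (ler_normD _ _)) //.
rewrite normrN lerD2l mulrCA -[leLHS]mulr1 ler_wpM2l //.
by rewrite ler_pdivlMr // mul1r rge // mem_head.
Qed.

Definition posn (z : int) : nat := if z is Posz k then k else 0.
Definition negn (z : int) : nat := if z is Negz k then k.+1 else 0.

(** The equation [u^l = 1] with denominators cleared, hence polynomial along lines. *)
Definition binomial_val (F : fieldType) N (l : 'rV[int]_N) (u : 'rV[F]_N) : F :=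
  \prod_i u 0 i ^+ posn (l 0 i) - \prod_i u 0 i ^+ negn (l 0 i).

Definition binomial_line (F : fieldType) N (l : 'rV[int]_N) (u v : 'rV[F]_N) :
    {poly F} :=
  \prod_i ((u 0 i)%:P + v 0 i *: 'X) ^+ posn (l 0 i) -
  \prod_i ((u 0 i)%:P + v 0 i *: 'X) ^+ negn (l 0 i).

Lemma horner_binomial_line (F : fieldType) N (l : 'rV[int]_N) (u v : 'rV[F]_N) t :
  (binomial_line l u v).[t] = binomial_val l (u + t *: v).
Proof.
rewrite hornerD hornerN !horner_prod; congr (_ - _);
  by apply: eq_bigr => i _; rewrite !hornerE !mxE [t * _]mulrC.
Qed.

Lemma binomial_val_eq0 (F : fieldType) N (l : 'rV[int]_N) (u : 'rV[F]_N) :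
  torus u -> (binomial_val l u == 0) = (monom u l == 1).
Proof.
move/torusP=> u0.
have -> : monom u l =
    \prod_i u 0 i ^+ posn (l 0 i) / \prod_i u 0 i ^+ negn (l 0 i).
  rewrite -prodfV -big_split; apply: eq_bigr => i _ /=.
  case: (l 0 i) => k; first by rewrite expr0 invr1 mulr1.
  by rewrite expr0 mul1r NegzE -invr_expz.
rewrite subr_eq0; set q := \prod_i u 0 i ^+ negn _.
have q0 : q != 0 by apply/prodf_neq0 => i _; rewrite expf_neq0.
by apply/eqP/eqP => [->|/(canRL (divfK q0)) ->]; rewrite ?divff ?mul1r.
Qed.

(** A degree bound independent of the line, so that the growth factor in the root estimate can be
    fixed before the line moves. *)
Lemma size_binomial_line (F : fieldType) N (l : 'rV[int]_N) :
  exists D, forall u v : 'rV[F]_N, ((size (binomial_line l u v)).-1 <= D)%N.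
Proof.
have szl (a b : F) k : (size (((a%:P + b *: 'X) ^+ k)%R) <= k.+1)%N.
  apply: leq_trans (size_poly_exp_leq _ _) _.
  have : (size (a%:P + b *: 'X)%R <= 2)%N.
    rewrite (leq_trans (size_polyD _ _)) // geq_max (leq_trans (size_polyC_leq1 _)) //.
    by rewrite (leq_trans (size_scale_leq _ _)) // size_polyX.
  by case: (size _) => [|[|[]]] //=; lia.
exists (\sum_i (posn (l 0%R i)).+1 + \sum_i (negn (l 0%R i)).+1)%N => u v.
have szp (f : 'I_N -> nat) :
    (size (\prod_i ((u 0 i)%:P + v 0 i *: 'X) ^+ f i)%R <= (\sum_i (f i).+1).+1)%N.
  apply: leq_trans (size_poly_prod_leq _ _) _.
  apply: leq_trans (leq_subr _ _) _; rewrite ltnS.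
  by apply: leq_sum => i _.
have := size_polyD (\prod_i ((u 0 i)%:P + v 0 i *: 'X) ^+ posn (l 0 i))
  (- \prod_i ((u 0 i)%:P + v 0 i *: 'X) ^+ negn (l 0 i)).
rewrite -/(binomial_line l u v) size_polyN.
have := szp (fun i => posn (l 0 i)); have := szp (fun i => negn (l 0 i)).
move: (size _) (size _) (size _) (\sum_i _)%N (\sum_i _)%N => x y z p q; lia.
Qed.

Lemma torus_near (C : numFieldType) N (e a b : 'rV[C]_N) : torus e ->
  exists2 r, 0 < r & forall s t, `|s| < r -> `|t| < r ->
    torus (e + s *: a + t *: b).
Proof.
move/torusP=> e0.
(* With radius [M^-1], each coordinate of the perturbation is smaller than that of [e]; the summand
   1 makes this strict. *)
pose M := 1 + \sum_i (`|a 0 i| + `|b 0 i|) / `|e 0 i|.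
have term_ge0 i : 0 <= (`|a 0 i| + `|b 0 i|) / `|e 0 i|.
  by rewrite divr_ge0 // addr_ge0.
have M0 : 0 < M by rewrite ltr_wpDr // sumr_ge0.
exists M^-1; first by rewrite invr_gt0.
move=> s t sM tM; apply/torusP => i; rewrite !mxE -addrA.
have ei : 0 < `|e 0 i| by rewrite normr_gt0.
have iM : (`|a 0 i| + `|b 0 i|) / `|e 0 i| < M.
  rewrite /M (bigD1 i) //= addrCA ltrDl ltr_wpDr // sumr_ge0 //.
suff : `|s * a 0 i + t * b 0 i| < `|e 0 i|.
  by apply: contraTneq => /eqP; rewrite addr_eq0 => /eqP ->; rewrite normrN ltxx.
apply: le_lt_trans (_ : M^-1 * (`|a 0 i| + `|b 0 i|) < _); last first.
  by rewrite mulrC ltr_pdivrMr // mulrC -ltr_pdivrMr.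
rewrite (le_trans (ler_normD _ _)) // mulrDr !normrM.
by rewrite lerD // ler_wpM2r // ltW.
Qed.

(* If the binomial does not vanish along [b], then for small [s] its
   restriction to the line [e + s a + C b] takes a small value at [0] and a
   non-small one at some fixed point, so it has a root near [0]. *)
Lemma infinite_binomial_zeros (C : numClosedFieldType) N (l : 'rV[int]_N)
    (e a b : 'rV[C]_N) (f g : 'cV[C]_N) (U : seq 'rV[C]_N) :
  torus e -> monom e l = 1 ->
  a *m f = 1%:M -> b *m f = 0 -> a *m g = 0 -> b *m g = 1%:M ->
  exists s t, [/\ torus (e + s *: a + t *: b),
    monom (e + s *: a + t *: b) l = 1 & e + s *: a + t *: b \notin U].
Proof.
move=> te el af bf ag bg.
have [r r0 near] := torus_near a b te.
(* [f] and [g] are dual to [a] and [b], so they read [s] and [t] off a point; avoiding [U] reduces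
   to avoiding finitely many scalars. *)
have sE s t : ((e + s *: a + t *: b - e) *m f) 0 0 = s.
  rewrite [_ - e]addrC !addrA addNr add0r mulmxDl -!scalemxAl af bf scaler0 addr0.
  by rewrite !mxE mulr1.
have tE s t : ((e + s *: a + t *: b - e) *m g) 0 0 = t.
  rewrite [_ - e]addrC !addrA addNr add0r mulmxDl -!scalemxAl ag bg scaler0 add0r.
  by rewrite !mxE mulr1.
have e_val : binomial_val l e = 0 by apply/eqP; rewrite binomial_val_eq0 // el.
have [b_const|b_var] := eqVneq (binomial_line l e b) 0.
  have [t [t0 tr tU]] := fresh_small [seq ((u - e) *m g) 0 0 | u <- U] r0.
  exists 0, t; have tu : torus (e + 0 *: a + t *: b).
    by apply: near; rewrite ?normr0 // gtr0_norm.
  split=> //.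
    apply/eqP; rewrite -binomial_val_eq0 // scale0r addr0.
    by rewrite -horner_binomial_line b_const horner0.
  by apply: contra tU => uU; apply/mapP; exists (e + 0 *: a + t *: b).
have [t1 t1P] : exists t1, (binomial_line l e b).[t1] != 0.
  have [rs rsE] := closed_field_poly_normal (binomial_line l e b).
  have [t1 [_ _ t1rs]] := fresh_small rs (ltr01 : 0 < 1 :> C).
  exists t1; rewrite rsE hornerZ mulf_neq0 ?lead_coef_eq0 //.
  by rewrite -[_ != 0]/(~~ root _ _) root_prod_XsubC.
have [D szD] := size_binomial_line C l.
pose q := binomial_line l (e + t1 *: b) a; pose p := binomial_line l e a.
(* [K] bounds the growth factor on all the lines [e + s a + C b] at once. *)
pose K := (1 + `|t1| / r) ^+ D.
have K1 : 1 <= K.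
  by rewrite exprn_ege1 // lerDl divr_ge0 // ltW.
have q00 : 0 < `|q.[0]|.
  by rewrite normr_gt0 /q horner_binomial_line scale0r addr0 -horner_binomial_line.
have h0 : 0 < `|q.[0]| / 2 by rewrite divr_gt0.
have [d1 d10 qd1] := horner_cont0 q h0.
(* Dividing by [K] keeps [K] times the value at 0 below half of [|q.[0]|], hence below the value at
   [t1]. *)
have [d2 d20 pd2] := horner_cont0 p (divr_gt0 h0 (lt_le_trans ltr01 K1)).
have [d3 [d30 d31 d32]] := pos_lower_bound d10 d20.
have [d [d0 dd3 dr]] := pos_lower_bound d30 r0.
have [s [s0 sd sU]] := fresh_small [seq ((u - e) *m f) 0 0 | u <- U] d0.
have sn : `|s| = s by rewrite gtr0_norm.
have {}qd1 := qd1 s; have {}pd2 := pd2 s; rewrite sn in qd1 pd2.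
have {}qd1 := qd1 (lt_le_trans sd (le_trans dd3 d31)).
have {}pd2 := pd2 (lt_le_trans sd (le_trans dd3 d32)).
pose h := binomial_line l (e + s *: a) b.
have ht1 : h.[t1] = q.[s] by rewrite !horner_binomial_line addrAC.
have hh0 : h.[0] = p.[s] - p.[0].
  by rewrite !horner_binomial_line !scale0r !addr0 e_val subr0.
have qs : `|q.[0]| / 2 < `|q.[s]|.
  rewrite -(ltrD2l (`|q.[0]| / 2)) -splitr.
  apply: le_lt_trans (_ : `|q.[s] - q.[0]| + `|q.[s]| < _); last by rewrite ltrD2r.
  by rewrite distrC -{1}[q.[0]](subrK q.[s]) ler_normD.
have h_small : `|h.[0]| * (1 + `|t1| / r) ^+ (size h).-1 < `|h.[t1]|.
  apply: le_lt_trans (_ : `|h.[0]| * K < _).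
    rewrite ler_wpM2l // /K ler_weXn2l ?szD //.
    by rewrite lerDl divr_ge0 // ltW.
  rewrite hh0 ht1 (lt_trans _ qs) //.
  by rewrite -ltr_pdivlMr // (lt_le_trans ltr01).
have h0' : h != 0.
  by apply: contraTneq h_small => ->; rewrite !horner0 normr0 mul0r ltxx.
have [rs rsE] := closed_field_poly_normal h.
have rs_root z : (z \in rs) = root h z.
  by rewrite rsE rootZ ?lead_coef_eq0 // root_prod_XsubC.
have /allPn[t t_rs t_small] : ~~ all (fun z => r <= `|z|) rs.
  apply/negP => /allP rs_ge.
  have := @horner_le_of_roots_ge _ h r t1 r0.
  have rs_ge' z : root h z -> r <= `|z| by rewrite -rs_root; apply: rs_ge.
  by move=> /(_ rs_ge') /(lt_le_trans h_small); rewrite ltxx.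
have tr : `|t| < r by rewrite real_ltNge ?ger0_real // ltW.
exists s, t; have tu : torus (e + s *: a + t *: b).
  by apply: near => //; rewrite sn (lt_le_trans sd).
split=> //.
  apply/eqP; rewrite -binomial_val_eq0 // -horner_binomial_line.
  by rewrite -[_ == 0]/(root _ _) -rs_root.
by apply: contra sU => uU; apply/mapP; exists (e + s *: a + t *: b).
Qed.

(* Stdlib binds [R_scope] to [R], which would give arguments of type [R] the
   Stdlib operations. *)
Bind Scope ring_scope with R.

(** * Products of powers of affine functions *)

(** [y] plays the logarithmic derivative, phrased without division; products become sums. *)
Definition dlog (f : R -> R) (x y : R) := derivable_pt_lim f x (f x * y).

Lemma dlog_ext f g x y : f =1 g -> dlog f x y -> dlog g x y.
Proof. by move=> fg; rewrite /dlog fg; apply: derivable_pt_lim_ext. Qed.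

Lemma dlog_const c x : dlog (fun=> c) x 0.
Proof. by rewrite /dlog mulr0; apply: derivable_pt_lim_const. Qed.

Lemma dlogM f g x y z : dlog f x y -> dlog g x z ->
  dlog (fun t => f t * g t) x (y + z).
Proof.
move=> df dg; rewrite /dlog.
rewrite (_ : _ * (y + z) = f x * y * g x + f x * (g x * z)); last by ring.
exact: derivable_pt_lim_mult df dg.
Qed.

Lemma dlogV f x y : f x != 0 -> dlog f x y -> dlog (fun t => (f t)^-1) x (- y).
Proof.
move=> fx0 df.
have := derivable_pt_lim_div (fun=> 1) f x _ _ (derivable_pt_lim_const 1 x) df.
move/(_ (elimN eqP fx0)); rewrite /dlog.
set d := (X in derivable_pt_lim _ _ X -> _) => H.
rewrite (_ : _ * - y = d); last first.
  rewrite /d /Rsqr /Rdiv RinvE RminusE !RmultE -[IZR Z0]/(0 : R).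
  by field.
by apply: derivable_pt_lim_ext H => t; rewrite /div_fct /Rdiv RinvE RmultE mul1r.
Qed.

Lemma dlogX f x y n : dlog f x y -> dlog (fun t => f t ^+ n) x (n%:R * y).
Proof.
move=> df; elim: n => [|n IH].
  by rewrite mul0r; apply: dlog_ext (dlog_const 1 x) => t; rewrite expr0.
rewrite (_ : _ * y = y + n%:R * y); last by rewrite -natr1; ring.
by apply: dlog_ext (dlogM df IH) => t; rewrite exprS.
Qed.

Lemma dlogXz f x y (z : int) : f x != 0 -> dlog f x y ->
  dlog (fun t => f t ^ z) x (z%:~R * y).
Proof.
move=> fx0 df; case: z => n; first exact: dlogX.
rewrite NegzE mulrNz mulNr.
apply: dlog_ext (dlogV _ (dlogX n.+1 df)); last exact: expf_neq0.
by move=> t; rewrite -invr_expz.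
Qed.

Lemma dlog_prod (I : Type) (r : seq I) (P : pred I) (f : I -> R -> R) x y :
  (forall i, P i -> dlog (f i) x (y i)) ->
  dlog (fun t => \prod_(i <- r | P i) f i t) x (\sum_(i <- r | P i) y i).
Proof.
move=> df; elim: r => [|i r IH].
  by rewrite big_nil; apply: dlog_ext (dlog_const 1 x) => t; rewrite big_nil.
rewrite big_cons; case: ifP => Pi; last first.
  by apply: dlog_ext IH => t; rewrite big_cons Pi.
by apply: dlog_ext (dlogM (df i Pi) IH) => t; rewrite big_cons Pi.
Qed.

Lemma dlog_affine (e a x : R) : e + x * a != 0 ->
  dlog (fun t => e + t * a) x (a / (e + x * a)).
Proof.
move=> L0; rewrite /dlog mulrC divfK //.
have := derivable_pt_lim_plus _ _ x _ _ (derivable_pt_lim_const e x)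
  (derivable_pt_lim_scal_right _ x _ a (derivable_pt_lim_id x)).
by rewrite RmultE RplusE add0r mul1r.
Qed.

Definition affine_form (N : nat) (e a : 'rV[R]_N) (i : 'I_N) (x : R) : R :=
  e 0 i + x * a 0 i.

Lemma affine_formE N (e a : 'rV[R]_N) i x :
  affine_form e a i x = (e + x *: a) 0 i.
Proof. by rewrite !mxE. Qed.

(** The relation monomial [u^l] along the line [e + x a], once [S] contains the support of [l]. *)
Definition master N (S : {set 'I_N}) (l : 'rV[int]_N) (e a : 'rV[R]_N) (x : R) :=
  \prod_(i in S) affine_form e a i x ^ l 0 i.

Definition master_dlog N (S : {set 'I_N}) (l : 'rV[int]_N) (e a : 'rV[R]_N) (x : R) :=
  \sum_(i in S) (l 0 i)%:~R * (a 0 i / affine_form e a i x).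

Lemma dlog_master N (S : {set 'I_N}) (l : 'rV[int]_N) (e a : 'rV[R]_N) x :
  (forall i, i \in S -> affine_form e a i x != 0) ->
  dlog (master S l e a) x (master_dlog S l e a x).
Proof.
move=> L0; apply: dlog_prod => i iS; apply: dlogXz; first exact: L0.
exact/dlog_affine/L0.
Qed.

Lemma master_MVT N (S : {set 'I_N}) (l : 'rV[int]_N) (e a : 'rV[R]_N) x y :
  x < y -> (forall i z, i \in S -> x <= z <= y -> affine_form e a i z != 0) ->
  exists2 z, x < z < y & master S l e a y - master S l e a x =
    master S l e a z * master_dlog S l e a z * (y - x).
Proof.
move=> xy L0.
have [||z [zE [/RltP xz /RltP zy]]] := MVT_cor2 (master S l e a)
    (fun z => master S l e a z * master_dlog S l e a z) x y.
- exact/RltP.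
- move=> z [/RleP xz /RleP zy]; apply: dlog_master => i iS.
  by apply: L0; rewrite // xz.
by exists z; rewrite ?xz.
Qed.

(* The numerator of [master_dlog]; index [i0] is left out because its form is
   constant, i.e. vanishes at infinity, which lowers the degree by one. *)
Definition critical_poly N (S : {set 'I_N}) i0 (l : 'rV[int]_N) (e a : 'rV[R]_N) :
    {poly R} :=
  \sum_(i in S :\ i0) ((l 0 i)%:~R * a 0 i) *:
    \prod_(j in S :\ i0 :\ i) ((e 0 j)%:P + a 0 j *: 'X).

(** Each summand is a product of [#|S| - 2] factors of degree at most one, and size exceeds degree
    by one. *)
Lemma size_critical_poly N (S : {set 'I_N}) i0 (l : 'rV[int]_N) (e a : 'rV[R]_N) :
  i0 \in S -> (size (critical_poly S i0 l e a) <= #|S|.-1)%N.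
Proof.
move=> i0S; apply: leq_trans (size_sum _ _ _) _; apply/bigmax_leqP => i iS.
apply: leq_trans (size_scale_leq _ _) _.
apply: leq_trans (size_poly_prod_leq _ _) _.
have := cardsD1 i0 S; have := cardsD1 i (S :\ i0); rewrite iS i0S => c1 c2.
have sz2 (j : 'I_N) : (size ((e 0 j)%:P + a 0 j *: 'X)%R <= 2)%N.
  rewrite (leq_trans (size_polyD _ _)) // geq_max (leq_trans (size_polyC_leq1 _)) //.
  by rewrite (leq_trans (size_scale_leq _ _)) // size_polyX.
have := leq_sum (index_enum 'I_N) (fun j _ => sz2 j) (P := [in S :\ i0 :\ i]).
rewrite sum_nat_const; move: c1 c2; set k := #|S :\ i0 :\ i|.
rewrite -/k; move: (\sum_(j in _) _)%N => t; lia.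
Qed.

Lemma horner_critical_poly N (S : {set 'I_N}) i0 (l : 'rV[int]_N) (e a : 'rV[R]_N) x :
  i0 \in S -> a 0 i0 = 0 -> (forall i, i \in S -> affine_form e a i x != 0) ->
  (critical_poly S i0 l e a).[x] =
  master_dlog S l e a x * \prod_(j in S :\ i0) affine_form e a j x.
Proof.
move=> i0S ai0 L0; rewrite /critical_poly horner_sum.
have -> : master_dlog S l e a x =
    \sum_(i in S :\ i0) (l 0 i)%:~R * (a 0 i / affine_form e a i x).
  by rewrite /master_dlog (big_setD1 i0) //= ai0 mul0r mulr0 add0r.
rewrite mulr_suml; apply: eq_bigr => i iS; rewrite hornerZ horner_prod.
have /L0 Li : i \in S by move: iS; rewrite inE => /andP[].
rewrite [in RHS](big_setD1 i) //= -!mulrA mulKf //.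
congr (_ * (_ * _)); apply: eq_bigr => j _; rewrite !hornerE /affine_form.
by rewrite mulrC.
Qed.

(** The derivative vanishes somewhere in between by the mean value theorem; [master] does not, so
    its logarithmic derivative does. *)
Lemma master_rolle N (S : {set 'I_N}) i0 (l : 'rV[int]_N) (e a : 'rV[R]_N) x y :
  i0 \in S -> a 0 i0 = 0 -> x < y ->
  (forall i z, i \in S -> x <= z <= y -> affine_form e a i z != 0) ->
  master S l e a x = master S l e a y ->
  exists2 z, x < z < y & root (critical_poly S i0 l e a) z.
Proof.
move=> i0S ai0 xy L0 Gxy; have [z zxy] := master_MVT l xy L0.
have L0z i : i \in S -> affine_form e a i z != 0.
  by move=> iS; apply: L0 => //; case/andP: zxy => /ltW-> /ltW->.
rewrite Gxy subrr => /esym/eqP; rewrite !mulf_eq0 subr_eq0 (gt_eqF xy) orbF.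
case/orP=> [|D0]; last first.
  exists z => //; rewrite /root horner_critical_poly //.
  by rewrite (eqP D0) mul0r.
by case/prodf_eq0 => i iS; rewrite expfz_eq0 (negPf (L0z i iS)) andbF.
Qed.

Lemma master_const N (S : {set 'I_N}) i0 (l : 'rV[int]_N) (e a : 'rV[R]_N) x y :
  i0 \in S -> a 0 i0 = 0 -> x < y ->
  (forall i z, i \in S -> x <= z <= y -> affine_form e a i z != 0) ->
  critical_poly S i0 l e a = 0 -> master S l e a x = master S l e a y.
Proof.
move=> i0S ai0 xy L0 N0; have [z zxy] := master_MVT l xy L0.
have L0z i : i \in S -> affine_form e a i z != 0.
  by move=> iS; apply: L0 => //; case/andP: zxy => /ltW-> /ltW->.
have /esym/eqP := horner_critical_poly l i0S ai0 L0z.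
rewrite N0 horner0 mulf_eq0 => /orP[/eqP ->|].
  by rewrite mulr0 mul0r => /eqP; rewrite subr_eq0 => /eqP.
by case/prodf_eq0 => i; rewrite inE => /andP[_ /L0z /negPf ->].
Qed.

(** * Signs *)

Lemma oppr_F2 (x : 'F_2) : - x = x.
Proof. by case: x => [[|[|[]]] //] ?; apply: val_inj. Qed.

(** The sign character of the nonzero reals, written additively so that signs of monomials become
    linear algebra over F_2. *)
Definition sgn2 (x : R) : 'F_2 := (x < 0)%R%:R.

Lemma sgn2_eq x y : (sgn2 x == sgn2 y) = ((x < 0) == (y < 0)).
Proof. by rewrite /sgn2; do 2 case: (_ < _). Qed.

Lemma sgn2M x y : x != 0 -> y != 0 -> sgn2 (x * y) = sgn2 x + sgn2 y.
Proof.
rewrite /sgn2 !neq_lt; case: (ltgtP x 0) => // x0 _; case: (ltgtP y 0) => // y0 _.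
- by rewrite ltNge ltW ?nmulr_rgt0 //; apply: val_inj.
- by rewrite nmulr_rlt0 // y0; apply: val_inj.
- by rewrite pmulr_rlt0 // y0; apply: val_inj.
- by rewrite ltNge ltW ?mulr_gt0 //; apply: val_inj.
Qed.

Lemma sgn2V x : sgn2 x^-1 = sgn2 x.
Proof. by rewrite /sgn2 invr_lt0. Qed.

Lemma sgn2X x n : x != 0 -> sgn2 (x ^+ n) = n%:R * sgn2 x.
Proof.
move=> x0; elim: n => [|n IH]; first by rewrite expr0 mul0r /sgn2 ltr10.
by rewrite exprS sgn2M ?expf_neq0 // IH -[n.+1]add1n natrD mulrDl mul1r.
Qed.

Lemma sgn2Xz x (z : int) : x != 0 -> sgn2 (x ^ z) = z%:~R * sgn2 x.
Proof.
move=> x0; case: z => n; first exact: sgn2X.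
rewrite NegzE -invr_expz sgn2V [LHS]sgn2X // mulrNz mulNr.
by rewrite oppr_F2.
Qed.

Lemma sgn2_monom n (x : 'rV[R]_n) (b : 'rV[int]_n) : torus x ->
  sgn2 (monom x b) = \sum_k (b 0 k)%:~R * sgn2 (x 0 k).
Proof.
move/torusP=> x0; rewrite /monom.
suff [] : (\prod_k x 0 k ^ b 0 k != 0) /\
  sgn2 (\prod_k x 0 k ^ b 0 k) = \sum_k (b 0 k)%:~R * sgn2 (x 0 k) by [].
elim/big_rec2: _ => [|k s p _ [p0 ps]]; first by rewrite oner_neq0 /sgn2 ltr10.
by rewrite mulf_neq0 ?expfz_neq0 // sgn2M ?expfz_neq0 // sgn2Xz // ps.
Qed.

(** * Counting solutions on the line *)

Lemma affine_no_zero (e a x y z : R) : e + x * a != 0 -> e + y * a != 0 ->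
  (e + x * a < 0) = (e + y * a < 0) -> x <= z <= y -> e + z * a != 0.
Proof.
move=> x0 y0 xy /andP[xz zy].
case: (ltrP (e + x * a) 0) xy => Lx /esym; [move=> Ly | move/negbT; rewrite -leNgt => Ly].
  by rewrite lt_eqF //; case: (lerP 0 a) => a0; nra.
have {x0}Lx : 0 < e + x * a by rewrite lt_neqAle eq_sym x0.
have {y0}Ly : 0 < e + y * a by rewrite lt_neqAle eq_sym y0.
by rewrite gt_eqF //; case: (lerP 0 a) => a0; nra.
Qed.

Lemma affine_flip_once (e a x y z : R) : e + x * a != 0 -> e + y * a != 0 ->
  e + z * a != 0 -> x < y -> y <= z ->
  (e + x * a < 0) != (e + y * a < 0) -> (e + y * a < 0) = (e + z * a < 0).
Proof.
move=> x0 y0 z0 xy yz.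
case: (ltrgtP (e + x * a) 0) x0 => // Lx _; case: (ltrgtP (e + y * a) 0) y0 => // Ly _ _;
  case: (ltrgtP (e + z * a) 0) z0 => // Lz _; exfalso; nra.
Qed.

Definition flip_vector N (S : {set 'I_N}) (e a : 'rV[R]_N) (x y : R) :
    'rV['F_2]_N :=
  \row_i (if i \in S then sgn2 (affine_form e a i x) + sgn2 (affine_form e a i y) else 0).

Lemma addr_F2_eq0 (x y : 'F_2) : (x + y == 0) = (x == y).
Proof. by rewrite addr_eq0 oppr_F2. Qed.

(* Between two consecutive points either no form changes sign, and Rolle's
   theorem gives a root of the critical polynomial, or some form does.  Each
   form changes sign at most once, so the sign changes are independent. *)
Lemma critical_or_flip_count N (S : {set 'I_N}) i0 (l : 'rV[int]_N) (e a : 'rV[R]_N)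
    p (W : 'M['F_2]_(p, N)) (x : R) (s : seq R) :
  i0 \in S -> a 0 i0 = 0 -> path <%R x s ->
  (forall y i, y \in x :: s -> i \in S -> affine_form e a i y != 0) ->
  (forall y, y \in x :: s -> master S l e a y = 1) ->
  (forall y z, y \in x :: s -> z \in x :: s -> (flip_vector S e a y z <= W)%MS) ->
  exists (X : 'M['F_2]_N) (Y : seq R),
    [/\ (size s <= \rank X + size Y)%N, (X <= W)%MS,
        uniq Y /\ (forall z, z \in Y -> x <= z /\ root (critical_poly S i0 l e a) z)
      & forall i, i \in S -> sgn2 (affine_form e a i x) = sgn2 (affine_form e a i (last x s)) ->
          X *m delta_mx i (0 : 'I_1) = 0].
Proof.
(* The last clause of the statement is the invariant: [X] vanishes at the coordinates whose form has
   equal signs at both ends. *)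
move=> i0S ai0; elim: s x => [|y s IH] x /=.
  move=> _ _ _ _; exists 0, [::]; rewrite mxrank0 sub0mx; split=> // i _ _.
  by rewrite mul0mx.
case/andP=> xy ys L0 G1 HW.
have ys_in z : z \in y :: s -> z \in [:: x, y & s] by move=> zs; rewrite inE zs orbT.
have [|z i /ys_in|z /ys_in|z t /ys_in zs /ys_in|X [Y [szXY XW [uY Yroot] X0]]] := IH y.
- exact: ys.
- exact: L0.
- exact: G1.
- exact: HW.
have yz : y <= last y s.
  have := mem_last y s; rewrite inE => /orP[/eqP -> //|].
  by move/(allP (order_path_min lt_trans ys)) => /ltW.
have x_in : x \in [:: x, y & s] by rewrite mem_head.
have y_in : y \in [:: x, y & s] by rewrite ys_in // mem_head.
have z_in : last y s \in [:: x, y & s] by rewrite ys_in // mem_last.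
have once i : i \in S -> sgn2 (affine_form e a i x) != sgn2 (affine_form e a i y) ->
    sgn2 (affine_form e a i y) = sgn2 (affine_form e a i (last y s)).
  move=> iS; rewrite sgn2_eq => flip; apply/eqP; rewrite sgn2_eq; apply/eqP.
  exact: affine_flip_once (L0 _ _ x_in iS) (L0 _ _ y_in iS) (L0 _ _ z_in iS) xy yz flip.
have [/existsP[i /andP[iS flip]]|noflip] :=
    boolP [exists i, (i \in S) && (sgn2 (affine_form e a i x) != sgn2 (affine_form e a i y))].
  pose d := flip_vector S e a x y.
  have dE j : d *m delta_mx j (0 : 'I_1) = (d 0 j)%:M.
    by rewrite -colE; apply/matrixP => k1 k2; rewrite !mxE !ord1 eqxx mulr1n.
  (* Form [i] flips between [x] and [y], hence never afterwards; so [X] vanishes at coordinate [i],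
     whereas [d] does not. *)
  have dX : ~~ (d <= X)%MS.
    apply/negP => /submxP[D dX]; have /eqP := dE i.
    rewrite dX -mulmxA (X0 i iS (once i iS flip)) mulmx0 -dX eq_sym.
    move=> /eqP/matrixP/(_ 0 0); rewrite !mxE eqxx iS mulr1n.
    by move/eqP; rewrite addr_F2_eq0 (negPf flip).
  exists (X + d)%MS, Y; split.
  - have : (\rank X < \rank (X + d))%N.
      by apply: rank_ltmx; rewrite ltmxE addsmxSl addsmx_sub submx_refl /=.
    by move=> /=; lia.
  - by rewrite addsmx_sub XW HW.
  - by split=> // z /Yroot[yz' ?]; split=> //; rewrite (le_trans (ltW xy)).
  move=> j jS same.
  (* A form flipped between [x] and [y] would keep its new sign up to the last point. *)
  have same_xy : sgn2 (affine_form e a j x) = sgn2 (affine_form e a j y).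
    have [//|fl] := eqVneq (sgn2 (affine_form e a j x)) (sgn2 (affine_form e a j y)).
    by have := once j jS fl; rewrite -same => E; rewrite E eqxx in fl.
  apply/eqP; rewrite -submx0 addsmxMr addsmx_sub !submx0 X0 -?same_xy // eqxx /=.
  have d0 : d 0 j = 0 by apply/eqP; rewrite mxE jS addr_F2_eq0 same_xy.
  by rewrite dE d0 raddf0.
have same_xy i : i \in S -> sgn2 (affine_form e a i x) = sgn2 (affine_form e a i y).
  move=> iS; apply/eqP; apply: contraNT noflip => fl.
  by apply/existsP; exists i; rewrite iS.
have [||z /andP[xz zy] rz] := @master_rolle N S i0 l e a x y i0S ai0 xy.
- move=> i z iS xzy; have /eqP := same_xy i iS; rewrite sgn2_eq => /eqP same.
  exact: affine_no_zero (L0 _ _ x_in iS) (L0 _ _ y_in iS) same xzy.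
- by rewrite !G1.
exists X, (z :: Y); split=> //=.
- by move: szXY => /=; lia.
- split; last first.
    move=> t; rewrite inE => /orP[/eqP ->|/Yroot[yt ?]]; first by rewrite ltW.
    by rewrite (le_trans (ltW xy)).
  by rewrite uY andbT; apply: contraTN zy => /Yroot[yz' _]; rewrite -leNgt.
by move=> i iS; rewrite same_xy //; apply: X0.
Qed.

Definition set_row N (S : {set 'I_N}) : 'rV['F_2]_N := \row_i (i \in S)%:R.

(** There is one gap fewer than points. The constant form [i0] never flips, so [set_row S] is
    independent of the flip vectors; it takes up one dimension of [W], which makes up for the
    missing gap. *)
Lemma line_count N (S : {set 'I_N}) i0 (l : 'rV[int]_N) (e a : 'rV[R]_N)
    p (W : 'M['F_2]_(p, N)) (s : seq R) :
  i0 \in S -> a 0 i0 = 0 -> uniq s ->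
  critical_poly S i0 l e a != 0 ->
  (forall y i, y \in s -> i \in S -> affine_form e a i y != 0) ->
  (forall y, y \in s -> master S l e a y = 1) ->
  (forall y z, y \in s -> z \in s -> (flip_vector S e a y z <= W)%MS) ->
  (set_row S <= W)%MS ->
  (size s <= \rank W + (#|S| - 2))%N.
Proof.
move=> i0S ai0 us N0.
have srt : sorted <%R (sort <=%R s) by rewrite sort_lt_sorted.
move: (size_sort <=%R s) (mem_sort <=%R s) srt => <-.
case: (sort _ s) => [|x t] //= ms pth L0 G1 HW oneW.
have [y i|y|y z|X [Y [szXY XW [uY Yroot] X0]]] :=
  @critical_or_flip_count N S i0 l e a p W x t i0S ai0 pth.
- by rewrite ms; apply: L0.
- by rewrite ms; apply: G1.
- by rewrite !ms; apply: HW.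
have : (size Y < size (critical_poly S i0 l e a))%N.
  by apply: max_poly_roots => //; apply/allP => z /Yroot[].
have := size_critical_poly l e a i0S.
have : (\rank X < \rank W)%N.
  apply: leq_trans (_ : \rank (X + set_row S) <= _)%N.
    apply: rank_ltmx; rewrite ltmxE addsmxSl addsmx_sub submx_refl /=.
    apply/negP => /submxP[D DX].
    have := congr1 (fun M => M *m delta_mx i0 (0 : 'I_1)) DX.
    rewrite -mulmxA X0 // ?mulmx0 -?colE; last by rewrite /affine_form ai0 !mulr0.
    by move=> /matrixP/(_ 0 0); rewrite !mxE i0S.
  by apply: mxrankS; rewrite addsmx_sub XW.
have := cardsD1 i0 S; rewrite i0S.
move: szXY; move: (size (critical_poly _ _ _ _ _)) (size t) (size Y) => q t' y'.
by move: #|S| #|S :\ i0| (\rank X) (\rank W) => /=; lia.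
Qed.

(** * Circuits *)

(** Rows [(1, w_i)], whose left kernel consists of the affine relations among the [w_i]. *)
Definition hom_mx n (w : config n) : 'M[int]_(n.+2, n.+1) :=
  \matrix_(i, j) (if unlift ord0 j is Some k then w i 0 k else 1).

Definition hom_row (F : Type) n (s : F) (x : 'rV[F]_n) : 'rV[F]_n.+1 :=
  \row_j (if unlift ord0 j is Some k then x 0 k else s).

Lemma hom_mxE0 n (w : config n) i : hom_mx w i ord0 = 1.
Proof. by rewrite mxE unlift_none. Qed.

Lemma hom_mxES n (w : config n) i k : hom_mx w i (lift ord0 k) = w i 0 k.
Proof. by rewrite mxE liftK. Qed.

Lemma hom_rowE0 (F : Type) n (s : F) (x : 'rV[F]_n) : hom_row s x 0 ord0 = s.
Proof. by rewrite mxE unlift_none. Qed.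

Lemma hom_rowES (F : Type) n (s : F) (x : 'rV[F]_n) k :
  hom_row s x 0 (lift ord0 k) = x 0 k.
Proof. by rewrite mxE liftK. Qed.

(** For a kernel vector [(s, v')] the pairing of [v'] with [w_i] is the constant [- s], so [v'] is
    orthogonal to all differences, and these span. *)
Lemma hom_mx_inj n (w : config n) : full_affine_span w ->
  forall v : 'cV[int]_n.+1, hom_mx w *m v = 0 -> v = 0.
Proof.
move=> span v wv.
pose s := v ord0 0.
have [v' v'E] : exists v' : 'cV_n, forall k, v' k 0 = v (lift ord0 k) 0.
  by exists (\col_k v (lift ord0 k) 0) => k; rewrite mxE.
have eqs i : s + \sum_k w i 0 k * v' k 0 = 0.
  move/colP: wv => /(_ i); rewrite mxE [RHS]mxE big_ord_recl hom_mxE0 mul1r.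
  move=> svi; rewrite -[RHS]svi; congr (_ + _).
  by apply: eq_bigr => k _; rewrite hom_mxES v'E.
have v'0 : v' = 0.
  have /row_fullP[B BM] :
      row_full (\matrix_(i < n.+2) (toR (w i) - toR (w ord0))).
    by apply/eqP.
  have Mv : map_mx intr v' = 0 :> 'cV[R]_n.
    rewrite -[LHS]mul1mx -BM -mulmxA [X in B *m X](_ : _ = 0) ?mulmx0 //.
    apply/colP => i; rewrite !mxE.
    under eq_bigr => j _ do rewrite !mxE -rmorphB -rmorphM.
    rewrite -rmorph_sum /=; under eq_bigr do rewrite mulrBl.
    rewrite sumrB [X in (X - _)%:~R](_ : _ = - s); last by apply/eqP; rewrite -addr_eq0 addrC eqs.
    rewrite [X in (_ - X)%:~R](_ : _ = - s); last by apply/eqP; rewrite -addr_eq0 addrC eqs.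
    by rewrite subrr.
  apply/colP => k; move/colP: Mv => /(_ k); rewrite !mxE => /eqP.
  by rewrite intr_eq0 => /eqP.
have s0 : s = 0.
  by rewrite -[RHS](eqs ord0) v'0 big1 ?addr0 // => k _; rewrite mxE mulr0.
apply/colP => j; rewrite [RHS]mxE; case: (unliftP ord0 j) => [k|] -> //.
by rewrite -v'E v'0 mxE.
Qed.

Lemma mul_hom_mx (F : nzRingType) n (w : config n) (l : 'rV[F]_n.+2) :
  (l *m map_mx intr (hom_mx w) = 0) <->
  (\sum_i l 0 i = 0 /\ forall k, \sum_i l 0 i * (w i 0 k)%:~R = 0).
Proof.
have E j : (l *m map_mx intr (hom_mx w)) 0 j = \sum_i l 0 i * (hom_mx w i j)%:~R.
  by rewrite mxE; apply: eq_bigr => i _; rewrite mxE.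
have E0 : (l *m map_mx intr (hom_mx w)) 0 ord0 = \sum_i l 0 i.
  by rewrite E; apply: eq_bigr => i _; rewrite hom_mxE0 mulr1.
have ES k : (l *m map_mx intr (hom_mx w)) 0 (lift ord0 k) =
    \sum_i l 0 i * (w i 0 k)%:~R.
  by rewrite E; apply: eq_bigr => i _; rewrite hom_mxES.
split=> [lA|[l0 lw]].
  by split=> [|k]; [rewrite -E0|rewrite -ES]; rewrite lA mxE.
apply/rowP => j; rewrite [RHS]mxE; case: (unliftP ord0 j) => [k|] ->.
  by rewrite ES.
by rewrite E0.
Qed.

Definition norm_mon (F : fieldType) n (w : config n) i0 (x : 'rV[F]_n) :
    'rV[F]_n.+2 :=
  \row_i (monom x (w i) / monom x (w i0)).

Lemma pow_hom_mx (F : fieldType) n (w : config n) (s : F) (x : 'rV[F]_n) i :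
  pow_mx (hom_row s x) (hom_mx w) 0 i =
  s * monom x (w i).
Proof.
rewrite mxE /monom big_ord_recl hom_rowE0 mxE hom_mxE0 expr1z; congr (_ * _).
by apply: eq_bigr => k _; rewrite hom_rowES mxE hom_mxES.
Qed.

Lemma torus_hom_row (F : fieldType) n (s : F) (x : 'rV[F]_n) :
  s != 0 -> torus x -> torus (hom_row s x).
Proof.
move=> s0 /torusP x0; apply/torusP => j.
by case: (unliftP ord0 j) => [k|] ->; rewrite ?hom_rowES ?hom_rowE0.
Qed.

Lemma norm_mon_pow (F : fieldType) n (w : config n) i0 (x : 'rV[F]_n) :
  norm_mon w i0 x =
  pow_mx (hom_row (monom x (w i0))^-1 x) (hom_mx w).
Proof. by apply/rowP => i; rewrite mxE pow_hom_mx mulrC. Qed.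

Lemma norm_mon_torus (F : fieldType) n (w : config n) i0 (x : 'rV[F]_n) :
  torus x -> torus (norm_mon w i0 x).
Proof.
move=> tx; apply/torusP => i.
by rewrite mxE mulf_neq0 ?invr_eq0 ?monom_neq0.
Qed.

Lemma norm_mon_i0 (F : fieldType) n (w : config n) i0 (x : 'rV[F]_n) :
  torus x -> norm_mon w i0 x 0 i0 = 1.
Proof. by move=> tx; rewrite mxE divff // monom_neq0. Qed.

Lemma monom_norm_mon (F : fieldType) n (w : config n) i0 (x : 'rV[F]_n) P Q d :
  smith_form (hom_mx w) P Q d -> torus x ->
  monom (norm_mon w i0 x) (smith_rel P) = 1.
Proof.
move=> sm tx; rewrite norm_mon_pow monom_pow_mx ?(smith_relA sm) ?monom0 //.
by apply: torus_hom_row => //; rewrite invr_eq0 monom_neq0.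
Qed.

Lemma sys_eval_norm_mon (F : fieldType) (f : R -> F) n (c : 'M[R]_(n, n.+2))
    (w : config n) i0 (x : 'rV[F]_n) : torus x ->
  (forall j, sys_eval f c w j x = 0) <->
  norm_mon w i0 x *m (map_mx f c)^T = 0.
Proof.
move=> tx; have m0 := monom_neq0 (w i0) tx.
have E j : (norm_mon w i0 x *m (map_mx f c)^T) 0 j =
    sys_eval f c w j x / monom x (w i0).
  rewrite mxE /sys_eval mulr_suml; apply: eq_bigr => i _.
  by rewrite !mxE mulrC mulrA.
split=> [s0|/rowP s0 j]; first by apply/rowP => j; rewrite E s0 mul0r mxE.
have := s0 j; rewrite E mxE => /eqP.
by rewrite mulf_eq0 invr_eq0 (negPf m0) orbF => /eqP.
Qed.

(** Lifting [u] through [hom_mx w] gives [u_i = t x^(w_i)], and the normalization at [i0] fixes [t].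
    Hence [u] comes from one of the finitely many complex solutions. *)
Lemma finite_normalized_solutions n (w : config n) (c : 'M[R]_(n, n.+2)) i0 P Q d :
  smith_form (hom_mx w) P Q d -> generic_system c w ->
  exists U : seq 'rV[complex R]_n.+2, forall u, torus u -> u 0 i0 = 1 ->
    u *m (map_mx (fun r : R => (r%:C)%C) c)^T = 0 ->
    monom u (smith_rel P) = 1 -> u \in U.
Proof.
move=> sm [v _ [s [_ [_ sE]]]]; exists (map (norm_mon w i0) s) => u tu u1 uc ul.
have [y ty yu] := pow_mx_lift sm tu ul.
have yE : y = hom_row (y 0 ord0) (\row_k y 0 (lift ord0 k)).
  apply/rowP => j; case: (unliftP ord0 j) => [k|] ->.
    by rewrite hom_rowES mxE.
  by rewrite hom_rowE0.
move: (y 0 ord0) (\row_k _) yE => t x yE.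
have t0 : t != 0 by have /torusP/(_ ord0) := ty; rewrite yE hom_rowE0.
have tx : torus x.
  by apply/torusP => k; have /torusP/(_ (lift ord0 k)) := ty; rewrite yE hom_rowES.
have uE i : u 0 i = t * monom x (w i) by rewrite -yu yE pow_hom_mx.
have nu : norm_mon w i0 x = u.
  apply/rowP => i; rewrite mxE -[RHS]divr1 -u1 !uE.
  by rewrite -mulf_div divff // mul1r.
apply/mapP; exists x => //; apply/sE; split; first exact/torusP.
by apply/(sys_eval_norm_mon _ _ _ i0 tx); rewrite nu.
Qed.

(** * Coordinate masks and minimal dependent subsets *)

Definition mask_mx (F : fieldType) N (S : {set 'I_N}) : 'M[F]_N :=
  diag_mx (\row_i (i \in S)%:R).

Lemma mul_mask_mx (F : fieldType) N (S : {set 'I_N}) (v : 'rV[F]_N) :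
  v *m mask_mx F S = \row_i (if i \in S then v 0 i else 0).
Proof.
apply/rowP => j; rewrite mul_mx_diag !mxE.
by case: (_ \in _); rewrite ?mulr1 ?mulr0.
Qed.

Lemma rank_mask_mx_le (F : fieldType) N (S : {set 'I_N}) :
  (\rank (mask_mx F S) <= #|S|)%N.
Proof.
have -> : mask_mx F S = \sum_(i in S) delta_mx i i.
  apply/matrixP => j k; rewrite summxE !mxE.
  have [jS|jS] := boolP (j \in S).
    rewrite (bigD1 j) //= big1 ?addr0; last first.
      by move=> i /andP[_ ij]; rewrite mxE [j == i]eq_sym (negPf ij).
    by rewrite mxE eqxx /= eq_sym; case: eqP.
  rewrite mul0rn big1 // => i iS; rewrite mxE.
  by case: eqP => // ji; rewrite ji iS in jS.
rewrite -sum1_card; elim/big_rec2: _ => [|i k A _ IH]; first by rewrite mxrank0.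
by rewrite (leq_trans (mxrank_add _ _)) // leq_add // mxrank_delta.
Qed.

Lemma rank_mask_mx_ge (F : fieldType) N (S : {set 'I_N}) :
  (#|S| <= \rank (mask_mx F S))%N.
Proof.
have /(congr1 mxrank) : mask_mx F S + mask_mx F (~: S) = 1%:M.
  apply/matrixP => j k; rewrite !mxE inE.
  by case: (_ \in S); rewrite ?mul0rn ?addr0 ?add0r.
rewrite mxrank1 => rk1; have := mxrank_add (mask_mx F S) (mask_mx F (~: S)).
rewrite rk1; have := rank_mask_mx_le F (~: S).
have := cardsC S; rewrite card_ord; lia.
Qed.

(** For distinct [j0] and [i1] in [S], the differences from [w j0] of the remaining [#|S| - 2]
    points are independent: a relation among them would be an affine dependence on [S :\ i1]. *)
Lemma card_le_affine_dim n (w : config n) (S : {set 'I_n.+2}) :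
  min_aff_dependent w S -> (#|S| <= affine_dim w S + 2)%N.
Proof.
case=> [[lam [[i0 i0S _] _]] minS]; rewrite /affine_dim.
have j0S : odflt ord0 [pick j in S] \in S.
  by case: pickP => [j //|/(_ i0)]; rewrite i0S.
move: (odflt _ _) j0S => j0 j0S; set M := \matrix_(i < _) _.
have cardS := cardsD1 j0 S; rewrite j0S in cardS.
have [S1|/set0Pn[i1 i1S]] := eqVneq (S :\ j0) set0.
  by rewrite cardS S1 cards0; lia.
have cardS1 := cardsD1 i1 (S :\ j0); rewrite i1S in cardS1.
set T := S :\ j0 :\ i1 in cardS1.
suff rk : \rank (mask_mx R T *m M) = \rank (mask_mx R T).
  have := rank_mask_mx_ge R T; rewrite -rk => TM.
  rewrite cardS cardS1 -/T /= !add1n addn2 !ltnS.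
  exact: leq_trans TM (mxrankM_maxr _ _).
apply/mxrank_injP/rowV0P => v; rewrite sub_capmx => /andP[/submxP[D vD] /sub_kermxP vM].
have vE i : v 0 i = if i \in T then D 0 i else 0 by rewrite vD mul_mask_mx mxE.
have v_out i : i \notin T -> v 0 i = 0 by move=> /negPf iT; rewrite vE iT.
move: i1S; rewrite !inE => /andP[i1j0 i1S].
apply/eqP; apply: contraT => v0; case: (minS (S :\ i1)); first by rewrite properD1.
have /rV0Pn[k vk] := v0.
have kT : k \in T by apply: contraNT vk => /v_out ->.
have j0T : j0 \notin T by rewrite !inE eqxx andbF.
(* The coefficient at [j0] makes the total zero, turning a linear relation among differences into an
   affine one. *)
pose mu i := if i == j0 then - \sum_i v 0 i else v 0 i.
have sum_mu (V : lmodType R) (f : 'I_n.+2 -> V) :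
    \sum_i mu i *: f i = \sum_i v 0 i *: (f i - f j0).
  rewrite (bigD1 j0) //= {1}/mu eqxx.
  under [in RHS]eq_bigr do rewrite scalerBr.
  rewrite sumrB -scaler_suml scaleNr addrC; congr (_ - _).
  rewrite [RHS](bigD1 j0) //= v_out // scale0r add0r.
  by apply: eq_bigr => i /negPf ij; rewrite /mu ij.
exists mu; split; [|split; [|split]].
- exists k; first by move: kT; rewrite !inE => /and3P[-> _ ->].
  by rewrite /mu; have [kj0|] := eqVneq k j0; first by rewrite -kj0 kT in j0T.
- move=> i iS1; rewrite /mu; case: eqP => [ij|_].
    by move: iS1; rewrite ij !inE j0S andbT negbK eq_sym (negPf i1j0).
  by apply: v_out; apply: contra iS1; rewrite !inE => /and3P[-> _ ->].
- have := sum_mu R^o (fun=> 1); rewrite subrr.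
  under eq_bigr do rewrite /GRing.scale /= mulr1.
  by move=> ->; rewrite big1 // => i _; rewrite scaler0.
rewrite sum_mu -[RHS]vM mulmx_sum_row; apply: eq_bigr => i _.
have [iT|iT] := boolP (i \in T); last by rewrite v_out // !scale0r.
congr (_ *: _); apply/rowP => l; rewrite !mxE.
by move: iT; rewrite !inE => /and3P[_ _ ->]; rewrite !mxE.
Qed.

(** By uniqueness, the dependence on [S] is a nonzero multiple of [smith_rel P]. *)
Lemma relation_support n (w : config n) (S : {set 'I_n.+2}) P Q d :
  smith_form (hom_mx w) P Q d -> aff_dependent w S ->
  forall i, i \notin S -> smith_rel P 0 i = 0.
Proof.
move=> sm [lam [[k kS lamk] [lam_out [lam_sum lam_w]]]] i iS.
have [|t tE] := @smith_rel_unique R _ _ _ _ _ (\row_i lam i) sm.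
  apply/mul_hom_mx; split=> [|j].
    by rewrite -[RHS]lam_sum; apply: eq_bigr => j _; rewrite mxE.
  move/rowP: lam_w => /(_ j); rewrite summxE mxE => lamwj; rewrite -[RHS]lamwj.
  by apply: eq_bigr => m _; rewrite !mxE.
have t0 : t != 0.
  apply: contraNneq lamk => t0; move/rowP: tE => /(_ k).
  by rewrite t0 scale0r !mxE => ->.
move/rowP: tE => /(_ i); rewrite !mxE lam_out // => /esym/eqP.
by rewrite mulf_eq0 (negPf t0) /= intr_eq0 => /eqP.
Qed.

(** * Sign vectors of normalized monomials *)

Definition mod2_mx n (w : config n) : 'M['F_2]_(n, n.+2) :=
  \matrix_(k, i) (w i 0 k - w ord0 0 k)%:~R.

Definition sign_row n (x : 'rV[R]_n) : 'rV['F_2]_n := \row_k sgn2 (x 0 k).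

(** Signs of monomials depend linearly on signs of coordinates. Differences are taken from [w ord0]
    but the normalization uses [w i0]; the constant vector corrects this. *)
Lemma sgn2_norm_mon n (w : config n) i0 (x : 'rV[R]_n) : torus x ->
  map_mx sgn2 (norm_mon w i0 x) =
  sign_row x *m mod2_mx w + sgn2 (norm_mon w i0 x 0 ord0) *: const_mx 1.
Proof.
move=> tx; apply/rowP => i.
have sgnE j : sgn2 (norm_mon w i0 x 0 j) =
    \sum_k (w j 0 k)%:~R * sgn2 (x 0 k) + sgn2 (monom x (w i0)).
  have mj := monom_neq0 (w j) tx; have m0 := monom_neq0 (w i0) tx.
  by rewrite mxE sgn2M ?invr_eq0 // sgn2V !sgn2_monom.
rewrite mxE sgnE [in RHS]mxE [X in _ + X]mxE [const_mx _ _ _]mxE mulr1 sgnE addrA.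
congr (_ + _); rewrite mxE -big_split; apply: eq_bigr => k _ /=.
by rewrite !mxE rmorphB mulrBr mulrC [_ * sgn2 _]mulrC subrK.
Qed.

Definition sign_space n (w : config n) (S : {set 'I_n.+2}) : 'M['F_2]_n.+2 :=
  (mod2_mx w + (const_mx 1 : 'rV_n.+2))%MS *m mask_mx _ S.

Lemma rank_sign_space n (w : config n) S :
  (\rank (sign_space w S) <= (rank_mod2 w).+1)%N.
Proof.
apply: leq_trans (mxrankM_maxl _ _) _.
apply: leq_trans (mxrank_adds_leqif _ _) _.
by apply: leq_trans (leq_add (leqnn _) (rank_leq_row _)) _; rewrite (addn1 (\rank (mod2_mx w))).
Qed.

(** Modulo 2, [smith_rel P] is a nonzero vector supported on [S] and orthogonal to the sign space,
    which is thus a proper subspace of F_2^S. *)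
Lemma rank_sign_space_support n (w : config n) (S : {set 'I_n.+2}) P Q d :
  smith_form (hom_mx w) P Q d ->
  (forall i, i \notin S -> smith_rel P 0 i = 0) ->
  (\rank (sign_space w S) < #|S|)%N.
Proof.
move=> sm supp; apply: leq_trans (rank_mask_mx_le 'F_2 S).
pose l : 'cV['F_2]_n.+2 := (map_mx intr (smith_rel P))^T.
have maskl : mask_mx _ S *m l = l.
  apply: trmx_inj; rewrite trmx_mul trmxK tr_diag_mx mul_mask_mx.
  apply/rowP => i; rewrite [LHS]mxE; case: ifPn => // iS.
  by rewrite [RHS]mxE supp.
have [lsum lw] : \sum_i (map_mx intr (smith_rel P) : 'rV['F_2]_n.+2) 0 i = 0 /\
    forall k, \sum_i (map_mx intr (smith_rel P) : 'rV['F_2]_n.+2) 0 i * (w i 0 k)%:~R = 0.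
  by apply/mul_hom_mx; rewrite -map_mxM (smith_relA sm) map_mx0.
have space_l : sign_space w S *m l = 0.
  rewrite -mulmxA maskl; apply/eqP; rewrite -submx0 addsmxMr addsmx_sub !submx0.
  apply/andP; split; apply/eqP/colP => k; rewrite !mxE.
    transitivity (\sum_i (map_mx intr (smith_rel P) : 'rV['F_2]_n.+2) 0 i * (w i 0 k)%:~R
      - (\sum_i (map_mx intr (smith_rel P) : 'rV['F_2]_n.+2) 0 i) * (w ord0 0 k)%:~R).
      rewrite mulr_suml -sumrB; apply: eq_bigr => i _.
      by rewrite !mxE rmorphB /= mulrC mulrBr.
    by rewrite lw lsum mul0r subrr.
  by rewrite -[RHS]lsum; apply: eq_bigr => i _; rewrite !mxE mul1r.
apply: rank_ltmx; rewrite ltmxE submxMl /=; apply/negP => /submxP[D mD].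
have := maskl; rewrite mD -mulmxA space_l mulmx0 => /(congr1 trmx).
rewrite trmx0 trmxK => l0.
by have [uP _ _ _] := sm; have := smith_rel_mod2 uP; rewrite -l0 eqxx.
Qed.

Lemma flip_vector_sign_space n (w : config n) i0 (S : {set 'I_n.+2})
    (x y : 'rV[R]_n) (e a : 'rV[R]_n.+2) (s t : R) : torus x -> torus y ->
  norm_mon w i0 x = e + s *: a -> norm_mon w i0 y = e + t *: a ->
  (flip_vector S e a s t <= sign_space w S)%MS.
Proof.
move=> tx ty xE yE.
have -> : flip_vector S e a s t =
    (map_mx sgn2 (norm_mon w i0 x) + map_mx sgn2 (norm_mon w i0 y)) *m mask_mx _ S.
  rewrite mul_mask_mx; apply/rowP => i.
  by rewrite xE yE mxE [RHS]mxE; case: ifP => // _; rewrite !mxE.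
apply: submxMr; apply: addmx_sub; rewrite sgn2_norm_mon //; apply: addmx_sub_adds;
  rewrite ?submxMl // scalemx_sub //.
Qed.

Lemma set_row_sign_space n (w : config n) (S : {set 'I_n.+2}) :
  (set_row S <= sign_space w S)%MS.
Proof.
rewrite (_ : set_row S = (const_mx 1 : 'rV_n.+2) *m mask_mx _ S).
  by apply: submxMr; rewrite addsmxSr.
by rewrite mul_mask_mx; apply/rowP => i; rewrite !mxE; case: (_ \in _).
Qed.

(* Solutions with the same normalized monomials differ by a sign vector in the
   kernel of [mod2_mx w]. *)
Lemma fibre_size n (w : config n) i0 P Q d (xs : seq 'rV[R]_n) (u : 'rV[R]_n.+2) :
  smith_form (hom_mx w) P Q d -> uniq xs ->
  (forall x, x \in xs -> torus x /\ norm_mon w i0 x = u) ->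
  (size xs <= 2 ^ (n - rank_mod2 w))%N.
Proof.
move=> sm uxs xsP; case: xs uxs xsP => [//|x0 xs]; move: (x0 :: xs) (mem_head x0 xs).
move=> {xs}xs x0xs uxs xsP; have [tx0 x0u] := xsP _ x0xs.
have tu : torus u by rewrite -x0u norm_mon_torus.
(* Quotients by the fixed [x0] have all normalized monomials equal to 1, so their coordinates are 1
   or -1 and signs determine them. *)
pose r (x : 'rV[R]_n) : 'rV[R]_n := \row_k (x 0 k / x0 0 k).
have tr x : x \in xs -> torus (r x).
  move=> /xsP[tx _]; apply/torusP => k.
  by rewrite mxE mulf_neq0 ?invr_eq0 //; apply/torusP.
have r1 x : x \in xs -> norm_mon w i0 (r x) = const_mx 1.
  move=> xxs; have [tx xu] := xsP _ xxs; apply/rowP => i; rewrite !mxE !monom_div.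
  have ui y : y \in xs -> monom y (w i) = u 0 i * monom y (w i0).
    by move=> /xsP[ty <-]; rewrite mxE divfK // monom_neq0.
  rewrite !ui //; have /torusP/(_ i) := tu.
  have := monom_neq0 (w i0) tx; have := monom_neq0 (w i0) tx0 => a0 b0 c0.
  by field; rewrite a0 b0 c0.
have r_sign x : x \in xs -> forall k, r x 0 k = 1 \/ r x 0 k = -1.
  move=> xxs k; have := r1 x xxs; rewrite norm_mon_pow => h1.
  have th : torus (hom_row (monom (r x) (w i0))^-1 (r x)).
    by apply: torus_hom_row; rewrite ?invr_eq0 ?monom_neq0 ?tr.
  by have := pow_mx_sign sm th h1 (lift ord0 k); rewrite hom_rowES.
have signE x : x \in xs -> sign_row (r x) *m mod2_mx w = 0.
  move=> xxs; have := sgn2_norm_mon w i0 (tr x xxs).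
  rewrite r1 // map_const_mx mxE.
  have -> : sgn2 1 = 0 by rewrite /sgn2 ltr10.
  by rewrite scale0r addr0 => <-; apply/rowP => i; rewrite !mxE.
pose eps x := sign_row (r x).
have eps_inj : {in xs &, injective eps}.
  move=> x y xxs yxs /rowP exy; apply/rowP => k.
  have := exy k; rewrite /eps !mxE => /eqP; rewrite sgn2_eq.
  have /torusP/(_ k) x0k := tx0.
  suff : r x 0 k = r y 0 k -> x 0 k = y 0 k.
    move=> H; case: (r_sign x xxs k) => rx; case: (r_sign y yxs k) => ry;
    have rxE := rx; have ryE := ry; rewrite !mxE in rxE ryE; rewrite rxE ryE => sg;
      apply: H; rewrite rx ry //; exfalso; move: sg; rewrite ltr10 ltrN10 //.
  by rewrite !mxE => /(mulIf _); apply; rewrite invr_eq0.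
rewrite -(size_map eps); have ue : uniq (map eps xs) by rewrite map_inj_in_uniq.
have := uniq_leq_size ue (s2 := enum (rowg (kermx (mod2_mx w)))).
rewrite -cardE card_rowg mxrank_ker card_Fp //; apply.
by move=> _ /mapP[x xxs ->]; rewrite mem_enum mem_rowg; apply/sub_kermxP/signE.
Qed.

Lemma size_le_fibres (A B : eqType) (f : A -> B) (b : nat) (s : seq A) (t : seq B) :
  (forall x, x \in s -> f x \in t) ->
  (forall y, size [seq x <- s | f x == y] <= b)%N -> (size s <= b * size t)%N.
Proof.
elim: t s => [|y t IH] s st sb.
  by case: s st {sb} => // x s /(_ x (mem_head _ _)).
have := count_predC (fun x => f x == y) s; rewrite -!size_filter => <- /=.
rewrite mulnS leq_add ?sb //; apply: IH => [x|z].
  rewrite mem_filter => /andP[/= fx /st]; rewrite inE (negPf fx) //.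
rewrite -filter_predI; apply: leq_trans (sb z).
by rewrite !size_filter; apply: sub_count => x /andP[].
Qed.

Lemma monom_support (F : fieldType) N (S : {set 'I_N}) (l : 'rV[int]_N) (u : 'rV[F]_N) :
  (forall i, i \notin S -> l 0 i = 0) -> monom u l = \prod_(i in S) u 0 i ^ l 0 i.
Proof.
move=> supp; rewrite /monom [LHS](bigID [in S]) /= [X in _ * X]big1 ?mulr1 //.
by move=> i /supp ->; rewrite expr0z.
Qed.

(** * Finiteness over the complex numbers leaves a single real direction *)

Local Notation toC := (real_complex R).

Lemma torus_toC N (u : 'rV[R]_N) : torus u -> torus (map_mx toC u).
Proof. by move/torusP=> u0; apply/torusP => i; rewrite mxE fmorph_eq0. Qed.

Lemma monom_toC N (u : 'rV[R]_N) l : monom (map_mx toC u) l = toC (monom u l).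
Proof. by rewrite /monom rmorph_prod; apply: eq_bigr => i _; rewrite mxE fmorphXz. Qed.

Section FinitelyManySolutions.

(* A real point [e] of the linear system, normalized at [i0], whose monomial
   relation holds; only finitely many complex points have these properties. *)
Variables (n : nat) (c : 'M[R]_(n, n.+2)) (l : 'rV[int]_n.+2) (i0 : 'I_n.+2).
Variables (e : 'rV[R]_n.+2) (U : seq 'rV[complex R]_n.+2).
Hypothesis finite_U : forall u, torus u -> u 0 i0 = 1 ->
  u *m (map_mx toC c)^T = 0 -> monom u l = 1 -> u \in U.
Hypotheses (te : torus e) (e1 : e 0 i0 = 1) (ec : e *m c^T = 0) (el : monom e l = 1).

(** Its left kernel is the direction space of the linear system normalized at [i0]. *)
Let H := row_mx c^T (delta_mx i0 (0 : 'I_1)).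

Let mulH (v : 'rV[R]_n.+2) : (v *m H == 0) = (v *m c^T == 0) && (v 0 i0 == 0).
Proof.
rewrite mul_mx_row row_mx_eq0 -colE; congr (_ && _).
by apply/eqP/eqP => [/rowP/(_ 0)|v0]; [|apply/rowP => j; rewrite ord1]; rewrite !mxE.
Qed.

Let kerH (v : 'rV[R]_n.+2) : (v <= kermx H)%MS -> v *m c^T = 0 /\ v 0 i0 = 0.
Proof. by move/sub_kermxP/eqP; rewrite mulH => /andP[/eqP ? /eqP]. Qed.

(** Two independent directions would yield, by [infinite_binomial_zeros], a solution outside [U];
    the right inverse [B] of a basis supplies the dual functionals. *)
Lemma direction_space_rank : (\rank (kermx H) <= 1)%N.
Proof.
rewrite leqNgt; apply/negP => rk2.
have [B BE] := row_freeP (row_base_free (kermx H)).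
pose i1 : 'I_(\rank (kermx H)) := Ordinal (ltnW rk2); pose i2 := Ordinal rk2.
pose K := row_base (kermx H).
have Kij i j : row i K *m col j B = ((i == j)%:R)%:M.
  rewrite colE mulmxA -row_mul BE -colE; apply/matrixP => p q.
  by rewrite !ord1 !mxE eqxx mulr1n.
have KC i j : map_mx toC (row i K) *m map_mx toC (col j B) = ((i == j)%:R)%:M.
  by rewrite -map_mxM Kij map_scalar_mx rmorph_nat.
have Kc i : row i K *m c^T = 0 /\ row i K 0 i0 = 0.
  by apply: kerH; rewrite -(eq_row_base (kermx H)) row_sub.
have := @infinite_binomial_zeros _ _ l (map_mx toC e) (map_mx toC (row i1 K))
  (map_mx toC (row i2 K)) (map_mx toC (col i1 B)) (map_mx toC (col i2 B)) U.
rewrite !KC /= => /(_ (torus_toC te)).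
rewrite monom_toC el rmorph1 => /(_ erefl erefl (raddf0 _) (raddf0 _) erefl).
case=> s [t [tu ul]]; rewrite finite_U //.
  have comb (u v1 v2 : 'rV[complex R]_n.+2) p q : u 0 i0 = 1 -> v1 0 i0 = 0 ->
      v2 0 i0 = 0 -> (u + p *: v1 + q *: v2) 0 i0 = 1.
    by move=> u1 v10 v20; rewrite !mxE u1 v10 v20 !mulr0 !addr0.
  apply: comb; rewrite [LHS]mxE.
  - by rewrite e1 rmorph1.
  - by rewrite (Kc i1).2 rmorph0.
  by rewrite (Kc i2).2 rmorph0.
rewrite map_trmx !mulmxDl -!scalemxAl -!map_mxM ec.
by rewrite (Kc i1).1 (Kc i2).1 !map_mx0 !scaler0 !addr0.
Qed.

(** [H] has [n + 2] rows and [n + 1] columns, so its left kernel is nonzero, hence a line. *)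
Lemma direction_exists : exists a : 'rV[R]_n.+2,
  [/\ a != 0, a *m c^T = 0, a 0 i0 = 0
    & forall v, v *m c^T = 0 -> v 0 i0 = 0 -> exists t, v = t *: a].
Proof.
have rk1 : \rank (kermx H) = 1.
  apply/eqP; rewrite eqn_leq direction_space_rank mxrank_ker subn_gt0.
  by rewrite (leq_ltn_trans (rank_leq_col _)) // addn1.
have K0 : kermx H != 0 by rewrite -mxrank_eq0 rk1.
pose a := nz_row (kermx H).
have a0 : a != 0 by rewrite nz_row_eq0.
have aK : (a <= kermx H)%MS by apply: nz_row_sub.
have [ac ai0] := kerH aK; exists a; split=> // v vc vi0.
apply/sub_rVP; have /eqmxP -> : (a == kermx H)%MS.
  by rewrite -(geq_leqif (mxrank_leqif_eq aK)) rk1 lt0n mxrank_eq0.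
by apply/sub_kermxP/eqP; rewrite mulH vc vi0 !eqxx.
Qed.

(** Otherwise [master] stays equal to 1 near [e], and a small parameter [s] not occurring in [U]
    gives a further solution. *)
Lemma critical_poly_neq0 (S : {set 'I_n.+2}) (a : 'rV[R]_n.+2) :
  i0 \in S -> (forall i, i \notin S -> l 0 i = 0) ->
  a != 0 -> a *m c^T = 0 -> a 0 i0 = 0 -> critical_poly S i0 l e a != 0.
Proof.
move=> i0S supp a0 ac ai0; apply/eqP => N0.
have /rV0Pn[q aq] := a0.
have [r r0 near] := torus_near a 0 te.
have {}near s : `|s| < r -> torus (e + s *: a).
  by move=> sr; have := near s 0 sr; rewrite normr0 scale0r addr0; apply.
(* [coord] recovers the parameter of a point of the line from a coordinate where [a] is nonzero. *)
pose coord (u : 'rV[complex R]_n.+2) := (u 0 q - toC (e 0 q)) / toC (a 0 q).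
have [s [s0 sr sU]] := fresh_small [seq complex.Re (coord u) | u <- U] r0.
have form_neq0 i z : i \in S -> 0 <= z <= s -> affine_form e a i z != 0.
  move=> _ /andP[z0 zs]; have /torusP/(_ i) : torus (e + z *: a).
    by apply: near; rewrite ger0_norm // (le_lt_trans zs).
  by rewrite !mxE.
have := master_const i0S ai0 s0 form_neq0 N0.
have masterE z : master S l e a z = monom (e + z *: a) l.
  by rewrite (monom_support _ supp); apply: eq_bigr => i _; rewrite !mxE.
rewrite !masterE scale0r addr0 el => /esym sl.
move/negP: sU; apply; apply/mapP; exists (map_mx toC (e + s *: a)); last first.
  by rewrite /coord mxE -rmorphB -fmorph_div !mxE [e 0 q + _]addrC addrK mulfK.
apply: finite_U.
- by apply/torus_toC/near; rewrite gtr0_norm.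
- by rewrite !mxE ai0 mulr0 addr0 e1 rmorph1.
- by rewrite map_trmx -map_mxM mulmxDl -scalemxAl ec ac scaler0 addr0 map_mx0.
by rewrite monom_toC sl rmorph1.
Qed.

End FinitelyManySolutions.

(** * Combining the fibre bound with the count on the line *)

Lemma real_solution_count n (w : config n) (c : 'M[R]_(n, n.+2)) (S : {set 'I_n.+2})
    (sols : seq 'rV[R]_n) :
  is_circuit w -> min_aff_dependent w S -> generic_system c w -> uniq sols ->
  (forall x, x \in sols -> real_solution c w x) ->
  (size sols <= 2 ^ (n - rank_mod2 w) *
    (minn (rank_mod2 w) (affine_dim w S) + affine_dim w S + 1))%N.
Proof.
move=> [_ span] minS gen usols solP.
have [P [Q [d sm]]] := smith_form_exists (hom_mx_inj span).
have depS := minS.1; have supp := relation_support sm depS.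
have [_ [[i0 i0S _] _]] := depS.
case: sols usols solP => [//|x0 xs]; move: (x0 :: xs) (mem_head x0 xs) => {xs}sols x0s us solP.
have tsol x : x \in sols -> torus x by move=> /solP[x_neq0 _]; apply/torusP.
have csol x : x \in sols -> norm_mon w i0 x *m c^T = 0.
  move=> xs; have [_ /(sys_eval_norm_mon id c w i0 (tsol x xs))] := solP x xs.
  by rewrite map_mx_id.
have [U finU] := finite_normalized_solutions i0 sm gen.
pose e := norm_mon w i0 x0; have tx0 := tsol x0 x0s.
have te : torus e by apply: norm_mon_torus.
have e1 : e 0 i0 = 1 by apply: norm_mon_i0.
have el : monom e (smith_rel P) = 1 by apply: monom_norm_mon sm tx0.
have ec : e *m c^T = 0 by apply: csol.
have [a [a0 ac ai0 a_span]] := direction_exists finU te e1 ec el.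
have N0 := critical_poly_neq0 finU te e1 ec el i0S supp a0 ac ai0.
have /rV0Pn[q aq] := a0.
pose f x := (norm_mon w i0 x 0 q - e 0 q) / a 0 q.
have fE x : x \in sols -> norm_mon w i0 x = e + f x *: a.
  move=> xs; have [||t tE] := a_span (norm_mon w i0 x - e).
  - by rewrite mulmxBl csol // ec subrr.
  - by rewrite !mxE -/(norm_mon w i0 x 0 i0) !divff ?subrr // monom_neq0 // tsol.
  have ft : f x = t.
    have /rowP/(_ q) := tE; rewrite mxE [in X in _ + X]mxE [in RHS]mxE => tq.
    by rewrite /f tq mulfK.
  by rewrite ft -tE addrC subrK.
pose line := undup (map f sols).
have fibres : (size sols <= 2 ^ (n - rank_mod2 w) * size line)%N.
  apply: (@size_le_fibres _ _ f) => [x xs|y].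
    by rewrite mem_undup map_f.
  apply: (@fibre_size _ _ i0 P Q d _ (e + y *: a)) => //; first exact: filter_uniq.
  by move=> x; rewrite mem_filter => /andP[/eqP <- xs]; split; [apply: tsol|apply: fE].
apply: leq_trans fibres _; rewrite leq_mul2l; apply/orP; right.
have lineP y : y \in line -> exists2 x, x \in sols & norm_mon w i0 x = e + y *: a.
  by rewrite mem_undup => /mapP[x xs ->]; exists x => //; apply: fE.
have := @line_count _ S i0 (smith_rel P) e a _ (sign_space w S) line i0S ai0
  (undup_uniq _) N0.
have form_neq0 y i : y \in line -> i \in S -> affine_form e a i y != 0.
  move=> /lineP[x xs xE] _; have /torusP/(_ i) := norm_mon_torus w i0 (tsol x xs).
  by rewrite xE -affine_formE.
have master1 y : y \in line -> master S (smith_rel P) e a y = 1.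
  move=> /lineP[x xs xE]; have := monom_norm_mon i0 sm (tsol x xs).
  rewrite xE (monom_support _ supp) => <-.
  by apply: eq_bigr => i _; rewrite affine_formE.
have flips y z : y \in line -> z \in line ->
    (flip_vector S e a y z <= sign_space w S)%MS.
  move=> /lineP[x xs xE] /lineP[x' xs' xE'].
  exact: flip_vector_sign_space (tsol _ xs) (tsol _ xs') xE xE'.
move=> /(_ form_neq0 master1 flips (set_row_sign_space w S)).
(* The sign space has dimension at most [rk + 1] and at most [#|S| - 1], while [#|S| <= m + 2];
   adding [#|S| - 2] gives [minn rk m + m + 1]. *)
have := rank_sign_space w S; have := rank_sign_space_support sm supp.
have := card_le_affine_dim minS.
move: (affine_dim w S) #|S| (\rank (sign_space w S)) (rank_mod2 w) (size line) => m k r rk N.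
lia.
Qed.

Theorem theorem2p2 (n : nat) (w : config n) (c : 'M[R]_(n, n.+2))
  (S : {set 'I_n.+2}) :
  is_circuit w ->
  min_aff_dependent w S ->
  full_support c ->
  generic_system c w ->
  forall sols : seq 'rV[R]_n, uniq sols ->
    (forall x, x \in sols -> real_solution c w x) ->
    ((rank_mod2 w <= affine_dim w S)%N ->
       (size sols <= 2 ^ (n - rank_mod2 w) * (affine_dim w S + rank_mod2 w + 1))%N) /\
    ((affine_dim w S <= rank_mod2 w)%N ->
       (size sols <= 2 ^ (n - rank_mod2 w) * (2 * affine_dim w S + 1))%N).
Proof.
move=> circ minS _ gen sols us solP.
have := real_solution_count circ minS gen us solP.
rewrite mul2n -addnn => bound; split=> [/minn_idPl mE|/minn_idPr mE].
  by rewrite [X in (X + 1)%N]addnC -{2}mE.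
by rewrite -{1}mE.
Qed.
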